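(* Let $a,b,c,d\in\mathbb R$, $\delta:=c+d-a-b$, and assume $a,b,\delta>0$ and $d-a,\ d-b,\ c+1-a,\ c-b\notin\{0,-1,-2,\dots\}$. Let $q^{(n)}$, $n\ge 0$, be the type I linear forms defined in the context. Then for every integer $n\ge 0$, $$q^{(2n)}(1)=\frac{1}{(2n)!}\,\frac{(c)_{3n}(d)_{3n}}{(a)_{2n}(b)_{2n}},\qquad q^{(2n+1)}(1)=\frac{1}{(2n+1)!}\,\frac{(c)_{3n+2}(d)_{3n+1}}{(a)_{2n+1}(b)_{2n+1}}.$$
   Context: $(x)_k=x(x+1)\cdots(x+k-1)$, $(x)_0=1$, and ${}_2F_1$ is the Gauss hypergeometric function. On $(0,1)$ define $w_1(x)={}_2F_1(c-b,d-b;\delta;1-x)$, $w_2(x)=\frac{c}{b}\,{}_2F_1(c-b,d-b-1;\delta;1-x)$ (both extend continuously to $x=1$ with value $1$, resp. $c/b$), and $d\mu(x)=\frac{\Gamma(c)\Gamma(d)}{\Gamma(a)\Gamma(b)\Gamma(\delta)}x^{a-1}(1-x)^{\delta-1}dx$. Under the assumptions, for each $n\ge0$ there are unique polynomials $A_1^{(n)},A_2^{(n)}$ with $\deg A_1^{(n)}\le\lfloor n/2\rfloor$, $\deg A_2^{(n)}\le\lfloor (n-1)/2\rfloor$ ($A_2^{(0)}=0$) such that $q^{(n)}:=A_1^{(n)}w_1+A_2^{(n)}w_2$ satisfies $\int_0^1x^kq^{(n)}(x)\,d\mu(x)=0$ for $0\le k\le n-1$ and $\int_0^1x^nq^{(n)}(x)\,d\mu(x)=1$.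 $q^{(n)}(1)$ means $A_1^{(n)}(1)w_1(1)+A_2^{(n)}(1)w_2(1)$. *)

(* Defs.v *)
From Stdlib Require Import Reals Lra Arith Factorial.
From Coquelicot Require Import Coquelicot.
Open Scope R_scope.

Fixpoint poch (x : R) (k : nat) : R :=
  match k with
  | O => 1
  | S k' => poch x k' * (x + INR k')
  end.

Definition hyp2f1 (al be ga z : R) : R :=
  Series (fun k => poch al k * poch be k / (poch ga k * INR (fact k)) * z ^ k).

Definition GammaPos (s : R) : R :=
  RInt_gen (fun t => Rpower t (s - 1) * exp (- t)) (at_right 0) (Rbar_locally p_infty).

(* Gamma on all of R via Gamma(x) = Gamma(x+N) / (x)_N with N such that x+N > 0
   (at the poles x = 0,-1,-2,... this yields 0 by the convention / 0 = 0). *)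
Definition Gamma (x : R) : R :=
  let N := Z.to_nat (up (- x)) in GammaPos (x + INR N) / poch x N.

Definition nonpos_int (x : R) : Prop := exists m : nat, x = - INR m.

Definition delta (a b c d : R) : R := c + d - a - b.

Definition w1 (a b c d x : R) : R := hyp2f1 (c - b) (d - b) (delta a b c d) (1 - x).
Definition w2 (a b c d x : R) : R := c / b * hyp2f1 (c - b) (d - b - 1) (delta a b c d) (1 - x).

Fixpoint polyev (p : nat -> R) (m : nat) (x : R) : R :=
  match m with
  | O => 0
  | S m' => polyev p m' x + p m' * x ^ m'
  end.

(* number of coefficients: deg A1 <= floor(n/2), deg A2 <= floor((n-1)/2) (A2 = 0 if n = 0) *)
Definition nA1 (n : nat) : nat := (n / 2 + 1)%nat.
Definition nA2 (n : nat) : nat := ((n + 1) / 2)%nat.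

Definition qform (a b c d : R) (n : nat) (A1 A2 : nat -> R) (x : R) : R :=
  polyev A1 (nA1 n) x * w1 a b c d x + polyev A2 (nA2 n) x * w2 a b c d x.

(* q(1) := A1(1) w1(1) + A2(1) w2(1) with w1(1) = 1, w2(1) = c/b *)
Definition qform_at1 (a b c d : R) (n : nat) (A1 A2 : nat -> R) : R :=
  polyev A1 (nA1 n) 1 * 1 + polyev A2 (nA2 n) 1 * (c / b).

Definition mu_const (a b c d : R) : R :=
  Gamma c * Gamma d / (Gamma a * Gamma b * Gamma (delta a b c d)).

Definition mu_moment (a b c d : R) (f : R -> R) (k : nat) (v : R) : Prop :=
  is_RInt_gen
    (fun x => mu_const a b c d *
              (x ^ k * f x * Rpower x (a - 1) * Rpower (1 - x) (delta a b c d - 1)))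
    (at_right 0) (at_left 1) v.

Definition typeI (a b c d : R) (n : nat) (A1 A2 : nat -> R) : Prop :=
  (forall k : nat, (k < n)%nat -> mu_moment a b c d (qform a b c d n A1 A2) k 0) /\
  mu_moment a b c d (qform a b c d n A1 A2) n 1.

(* Main.v *)
(* Any solution [q] of the type I conditions satisfies [int P q dmu = p_n] for a polynomial
   [P = sum p_k x^k] of degree [n], so it suffices to find [P] with [int P q dmu = q(1)] on the
   whole space of linear forms, i.e. a reproducing kernel at 1. The moments are
   [int x^k w1 dmu = (a)_k (b)_k / ((c)_k (d)_k)] and
   [int x^k w2 dmu = (c/b) (b+k)/(c+k) int x^k w1 dmu] (Gauss's summation theorem). With
   [n = U + V], [p_k = (-1)^(n-k) (c)_(k+U) (d)_(k+V) / (k! (n-k)! (a)_k (b)_k)] makes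
   [int P x^i w1 dmu] and [(b/c) int P x^i w2 dmu] into the n-th divided difference at 0, ..., n of a
   monic polynomial of degree [n] in [k], which is 1; and [p_n] is the asserted value.
   If [c] or [d] is a pole of Gamma, then [mu = 0] and no type I form exists. *)
Require Import Defs.
From Stdlib Require Import Reals Arith Factorial Lra Lia Classical_Prop.
From Coquelicot Require Import Coquelicot.
Open Scope R_scope.

(** * Improper integrals over an open interval *)

(** The kernel coefficients are chosen for cancellation. Against [x^i w1] the k-th moment has
    numerator (a)_(k+i) (b)_(k+i) and denominator (c)_(k+i) (d)_(k+i). The factor (c)_(k+U)
    (d)_(k+V) clears the denominator for every [i] in use, and division by (a)_k (b)_k leaves a
    product of i + i + (U-i) + (V-i) = n monic linear factors in [k]. The result does not depend on
    [i], so the coefficients of [A1] and [A2] are merely added up, which is evaluation at 1. The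
    extra factor (b+k+i)/(c+k+i) for [w2] trades one factor in [c] for one in [b], at the price of i
    + 1 <= U; hence [c] gets the longer Pochhammer symbol when [n] is odd. The analytic effort lies
    in the moments: [c] or [d] may be negative, and the series for [w1] may diverge at x = 0 and
    change sign, so termwise integration rests on absolute summability after integration. Gauss's
    theorem is reached by sending the lower parameter to infinity along integer steps. *)

(* [Fa] and [Fb] converge to the left and right ends of the interval [I]. *)
Record exhausts (I : R -> Prop) (Fa Fb : (R -> Prop) -> Prop) : Prop := {
  exh_left : ProperFilter Fa;
  exh_right : ProperFilter Fb;
  exh_convex : forall x y z, I x -> I y -> x <= z <= y -> I z;
  exh_two : exists p q, I p /\ I q /\ p < q;
  exh_near_left : forall p, I p -> Fa (fun x => I x /\ x <= p);
  exh_near_right : forall p, I p -> Fb (fun x => I x /\ p <= x)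
}.

Definition unit_interval (x : R) : Prop := 0 < x < 1.
Definition half_line (x : R) : Prop := 0 < x.

Lemma exhausts_unit : exhausts unit_interval (at_right 0) (at_left 1).
Proof.
  split; unfold unit_interval.
  - apply at_right_proper_filter.
  - apply at_left_proper_filter.
  - intros; lra.
  - exists (1/3), (1/2); lra.
  - intros p Hp. exists (mkposreal p (proj1 Hp)). intros y Hy H0.
    change (Rabs (y - 0) < p) in Hy. apply Rabs_def2 in Hy. lra.
  - intros p Hp. assert (H : 0 < 1 - p) by lra. exists (mkposreal _ H). intros y Hy H0.
    change (Rabs (y - 1) < 1 - p) in Hy. apply Rabs_def2 in Hy. lra.
Qed.

Lemma exhausts_half_line : exhausts half_line (at_right 0) (Rbar_locally p_infty).
Proof.
  split; unfold half_line.
  - apply at_right_proper_filter.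
  - apply Rbar_locally_filter.
  - intros; lra.
  - exists 1, 2; lra.
  - intros p Hp. exists (mkposreal p Hp). intros y Hy H0.
    change (Rabs (y - 0) < p) in Hy. apply Rabs_def2 in Hy. lra.
  - intros p Hp. exists p. intros; lra.
Qed.

Section Improper.
Variables (I : R -> Prop) (Fa Fb : (R -> Prop) -> Prop).
Hypothesis HE : exhausts I Fa Fb.

Local Instance exhausts_left_proper : ProperFilter Fa := exh_left _ _ _ HE.
Local Instance exhausts_right_proper : ProperFilter Fb := exh_right _ _ _ HE.

Lemma exhausts_prod (p q : R) : I p -> I q ->
  filter_prod Fa Fb (fun ab => I (fst ab) /\ I (snd ab) /\ fst ab <= p /\ q <= snd ab).
Proof.
  intros Hp Hq.
  exists (fun x => I x /\ x <= p) (fun x => I x /\ q <= x).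
  - now apply (exh_near_left _ _ _ HE).
  - now apply (exh_near_right _ _ _ HE).
  - simpl; tauto.
Qed.

Lemma ex_RInt_within (f : R -> R) (x y : R) :
  (forall z, I z -> continuous f z) -> I x -> I y -> ex_RInt f x y.
Proof.
  intros Hf Hx Hy. apply (ex_RInt_continuous f). intros z Hz. apply Hf.
  destruct (Rle_dec x y).
  - rewrite Rmin_left, Rmax_right in Hz by lra. now apply (exh_convex _ _ _ HE x y).
  - rewrite Rmin_right, Rmax_left in Hz by lra. now apply (exh_convex _ _ _ HE y x).
Qed.

Lemma is_RInt_gen_intro (f : R -> R) (L : R) :
  (forall x y, I x -> I y -> x <= y -> ex_RInt f x y) ->
  (forall eps, 0 < eps -> exists p q, I p /\ I q /\ p <= q /\
     forall x y, I x -> I y -> x <= p -> q <= y -> Rabs (RInt f x y - L) < eps) ->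
  is_RInt_gen f Fa Fb L.
Proof.
  intros Hex H P [eps HP].
  destruct (H eps (cond_pos eps)) as (p & q & Hp & Hq & Hpq & H').
  unfold filtermapi. eapply filter_imp; [|exact (exhausts_prod p q Hp Hq)].
  intros [x y] (Hx & Hy & Hxp & Hqy); simpl in *.
  exists (RInt f x y). split.
  - apply (RInt_correct f), Hex; auto; lra.
  - apply HP. apply (H' x y); auto.
Qed.

(** Properness of the two filters yields one good window beyond any prescribed [p] and [q]. For
    integrands of constant sign, monotonicity later upgrades this to all larger windows. *)
Lemma is_RInt_gen_elim (f : R -> R) (L : R) :
  is_RInt_gen f Fa Fb L ->
  forall eps p q, 0 < eps -> I p -> I q ->
  exists x y, I x /\ I y /\ x <= p /\ q <= y /\ ex_RInt f x y /\ Rabs (RInt f x y - L) < eps.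
Proof.
  intros H eps p q He Hp Hq.
  assert (HL : locally L (fun v => Rabs (v - L) < eps)).
  { exists (mkposreal eps He). intros y Hy. exact Hy. }
  specialize (H _ HL). unfold filtermapi in H.
  assert (H2 := filter_and _ _ H (exhausts_prod p q Hp Hq)).
  destruct (filter_ex _ H2) as [[x y] [[v [Hv1 Hv2]] (Hx & Hy & Hxp & Hqy)]]; simpl in *.
  exists x, y. repeat split; auto.
  - now exists v.
  - now rewrite (is_RInt_unique _ _ _ _ Hv1).
Qed.

Lemma RInt_nonneg_mono (f : R -> R) (x p q y : R) :
  (forall z, I z -> continuous f z) -> (forall z, I z -> 0 <= f z) ->
  I x -> I y -> x <= p -> p <= q -> q <= y -> 0 <= RInt f p q <= RInt f x y.
Proof.
  intros Hc Hf Hx Hy Hxp Hpq Hqy.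
  assert (Hin : forall z, x <= z <= y -> I z) by (intros; now apply (exh_convex _ _ _ HE x y)).
  assert (Hi : forall u v, x <= u <= y -> x <= v <= y -> ex_RInt f u v)
    by (intros; apply ex_RInt_within; auto).
  assert (Hpos : forall u v, x <= u -> v <= y -> u <= v -> 0 <= RInt f u v).
  { intros u v Hu Hv Huv. apply RInt_ge_0; [lra| |].
    - apply Hi; lra.
    - intros z Hz. apply Hf, Hin; lra. }
  split; [apply Hpos; lra|].
  assert (E1 := RInt_Chasles f x p y (Hi x p ltac:(lra) ltac:(lra)) (Hi p y ltac:(lra) ltac:(lra))).
  assert (E2 := RInt_Chasles f p q y (Hi p q ltac:(lra) ltac:(lra)) (Hi q y ltac:(lra) ltac:(lra))).
  change (RInt f x p + RInt f p y = RInt f x y) in E1.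
  change (RInt f p q + RInt f q y = RInt f p y) in E2.
  assert (H1 := Hpos x p ltac:(lra) ltac:(lra) ltac:(lra)).
  assert (H2 := Hpos q y ltac:(lra) ltac:(lra) ltac:(lra)). lra.
Qed.

Lemma RInt_le_improper (f : R -> R) (L p q : R) :
  (forall z, I z -> continuous f z) -> (forall z, I z -> 0 <= f z) ->
  is_RInt_gen f Fa Fb L -> I p -> I q -> p <= q -> RInt f p q <= L.
Proof.
  intros Hc Hf HL Hp Hq Hpq. apply Rnot_lt_le. intro Hlt.
  destruct (is_RInt_gen_elim f L HL (RInt f p q - L) p q ltac:(lra) Hp Hq)
    as (x & y & Hx & Hy & Hxp & Hqy & _ & Hb).
  assert (H := RInt_nonneg_mono f x p q y Hc Hf Hx Hy Hxp Hpq Hqy).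
  apply Rabs_def2 in Hb. lra.
Qed.

(** For [f >= 0] the integral grows with the window and never exceeds [L], so one good window makes
    every larger one good. *)
Lemma improper_eventually (f : R -> R) (L : R) :
  (forall z, I z -> continuous f z) -> (forall z, I z -> 0 <= f z) ->
  is_RInt_gen f Fa Fb L ->
  forall eps, 0 < eps -> exists p q, I p /\ I q /\ p <= q /\
     forall x y, I x -> I y -> x <= p -> q <= y -> Rabs (RInt f x y - L) < eps.
Proof.
  intros Hc Hf HL eps He.
  destruct (exh_two _ _ _ HE) as (p0 & q0 & Hp0 & Hq0 & Hpq0).
  destruct (is_RInt_gen_elim f L HL eps p0 q0 He Hp0 Hq0)
    as (p & q & Hp & Hq & Hpp & Hqq & _ & Hb).
  exists p, q. repeat split; auto; [lra|].
  intros x y Hx Hy Hxp Hqy.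
  assert (H1 := RInt_nonneg_mono f x p q y Hc Hf Hx Hy Hxp ltac:(lra) Hqy).
  assert (H2 := RInt_le_improper f L x y Hc Hf HL Hx Hy ltac:(lra)).
  apply Rabs_def2 in Hb. apply Rabs_def1; lra.
Qed.

(** The value is the supremum of the integrals over compact windows; if no window came within [eps]
    of it, [L - eps] would still be an upper bound. *)
Lemma improper_exists (f : R -> R) (M : R) :
  (forall z, I z -> continuous f z) -> (forall z, I z -> 0 <= f z) ->
  (forall p q, I p -> I q -> p <= q -> RInt f p q <= M) ->
  exists L, is_RInt_gen f Fa Fb L.
Proof.
  intros Hc Hf HM.
  destruct (exh_two _ _ _ HE) as (p0 & q0 & Hp0 & Hq0 & Hpq0).
  set (E := fun v => exists p q, I p /\ I q /\ p <= q /\ v = RInt f p q).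
  destruct (completeness E) as [L [HL1 HL2]].
  - exists M. intros v (p & q & Hp & Hq & Hpq & ->). now apply HM.
  - exists (RInt f p0 q0), p0, q0. repeat split; auto; lra.
  - exists L. apply is_RInt_gen_intro.
    + intros; now apply ex_RInt_within.
    + intros eps He. apply NNPP. intro Hn.
      assert (Hub : is_upper_bound E (L - eps)).
      { intros v (p & q & Hp & Hq & Hpq & ->). apply Rnot_lt_le. intro Hlt.
        apply Hn. exists p, q. repeat split; auto.
        intros x y Hx Hy Hxp Hqy.
        assert (H1 := RInt_nonneg_mono f x p q y Hc Hf Hx Hy Hxp Hpq Hqy).
        assert (H2 : RInt f x y <= L).
        { apply HL1. exists x, y. repeat split; auto; lra. }
        apply Rabs_def1; lra. }
      specialize (HL2 _ Hub). lra.
Qed.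

Lemma improper_pos (f : R -> R) (L : R) :
  (forall z, I z -> continuous f z) -> (forall z, I z -> 0 < f z) ->
  is_RInt_gen f Fa Fb L -> 0 < L.
Proof.
  intros Hc Hf HL.
  destruct (exh_two _ _ _ HE) as (p & q & Hp & Hq & Hpq).
  assert (Hin : forall z, p <= z <= q -> I z) by (intros; now apply (exh_convex _ _ _ HE p q)).
  apply Rlt_le_trans with (RInt f p q).
  - apply RInt_gt_0; auto.
    + intros z Hz; apply Hf, Hin; lra.
  - apply RInt_le_improper; auto; try lra. intros; now apply Rlt_le, Hf.
Qed.

(** The end values enter as limits of [F], because the integrands of interest may be singular at the
    ends. *)
Lemma improper_FTC (F f : R -> R) (la lb : R) :
  (forall z, I z -> is_derive F z (f z)) -> (forall z, I z -> continuous f z) ->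
  filterlim F Fa (locally la) -> filterlim F Fb (locally lb) ->
  is_RInt_gen f Fa Fb (lb - la).
Proof.
  intros HF Hf Ha Hb P [eps HP].
  assert (He2 : 0 < eps / 2) by (assert (H := cond_pos eps); lra).
  destruct (exh_two _ _ _ HE) as (p & q & Hp & Hq & Hpq).
  assert (H1 : Fa (fun x => (I x /\ x <= p) /\ Rabs (F x - la) < eps / 2)).
  { apply filter_and; [now apply (exh_near_left _ _ _ HE)|].
    apply (Ha (fun v => Rabs (v - la) < eps / 2)).
    exists (mkposreal _ He2). intros y Hy; exact Hy. }
  assert (H2 : Fb (fun x => (I x /\ q <= x) /\ Rabs (F x - lb) < eps / 2)).
  { apply filter_and; [now apply (exh_near_right _ _ _ HE)|].
    apply (Hb (fun v => Rabs (v - lb) < eps / 2)).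
    exists (mkposreal _ He2). intros y Hy; exact Hy. }
  eexists; [exact H1|exact H2|].
  intros x y [[Hx Hxp] Hxa] [[Hy Hqy] Hyb]. simpl.
  assert (Hin : forall z, Rmin x y <= z <= Rmax x y -> I z).
  { intros z Hz. rewrite Rmin_left, Rmax_right in Hz by lra.
    now apply (exh_convex _ _ _ HE x y). }
  exists (F y - F x). split.
  - apply (is_RInt_derive F f); auto.
  - apply HP. change (Rabs ((F y - F x) - (lb - la)) < eps).
    apply Rabs_def2 in Hxa. apply Rabs_def2 in Hyb. apply Rabs_def1; lra.
Qed.

Lemma improper_le (f g : R -> R) (lf lg : R) :
  (forall z, I z -> f z <= g z) ->
  is_RInt_gen f Fa Fb lf -> is_RInt_gen g Fa Fb lg -> lf <= lg.
Proof.
  intros Hfg Hf Hg.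
  assert (Hd := is_RInt_gen_minus g f lg lf Hg Hf).
  apply Rnot_lt_le. intro Hlt.
  destruct (exh_two _ _ _ HE) as (p & q & Hp & Hq & Hpq).
  destruct (is_RInt_gen_elim _ _ Hd (lf - lg) p q ltac:(lra) Hp Hq)
    as (x & y & Hx & Hy & Hxp & Hqy & Hex & Hb).
  assert (H : 0 <= RInt (fun z => minus (g z) (f z)) x y).
  { apply RInt_ge_0; [lra|auto|]. intros z Hz.
    assert (Hz' : I z) by (apply (exh_convex _ _ _ HE x y); auto; lra).
    specialize (Hfg z Hz'). unfold minus, plus, opp; simpl. lra. }
  unfold minus, plus, opp in *; simpl in *.
  apply Rabs_def2 in Hb. lra.
Qed.

Lemma improper_ext (f g : R -> R) (l : R) :
  (forall z, I z -> f z = g z) -> is_RInt_gen f Fa Fb l -> is_RInt_gen g Fa Fb l.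
Proof.
  intros Hfg. apply is_RInt_gen_ext.
  destruct (exh_two _ _ _ HE) as (p & q & Hp & Hq & Hpq).
  eapply filter_imp; [|exact (exhausts_prod p q Hp Hq)].
  intros [x y] (Hx & Hy & Hxp & Hqy) z Hz; simpl in *.
  rewrite Rmin_left, Rmax_right in Hz by lra.
  apply Hfg. apply (exh_convex _ _ _ HE x y); auto; lra.
Qed.

Lemma improper_unique (f : R -> R) (l l' : R) :
  is_RInt_gen f Fa Fb l -> is_RInt_gen f Fa Fb l' -> l = l'.
Proof.
  intros H H'.
  apply Rle_antisym; eapply (improper_le f f); eauto; intros; apply Rle_refl.
Qed.

End Improper.

(** * Termwise integration *)

Lemma sum_n_Sn_R (u : nat -> R) (n : nat) : sum_n u (S n) = sum_n u n + u (S n).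
Proof. now rewrite sum_Sn. Qed.

Lemma sum_n_ge_0 (u : nat -> R) (n : nat) : (forall k, 0 <= u k) -> 0 <= sum_n u n.
Proof.
  intros H. induction n as [|n IH].
  - now rewrite sum_O.
  - rewrite sum_n_Sn_R. specialize (H (S n)). lra.
Qed.

Lemma sum_n_le_Series (u : nat -> R) (n : nat) :
  (forall k, 0 <= u k) -> ex_series u -> sum_n u n <= Series u.
Proof.
  intros H Hu. apply Series_correct in Hu.
  change (is_lim_seq (sum_n u) (Series u)) in Hu.
  apply (is_lim_seq_incr_compare (sum_n u)); auto.
  intros k. rewrite sum_n_Sn_R. specialize (H (S k)). lra.
Qed.

(** Both [m + u] and [m - u] have nonnegative terms, so their partial sums lie below their sums; the
    two inequalities bound the tail of [u] from either side. *)
Lemma Series_tail_le (u m : nat -> R) (n : nat) :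
  (forall k, Rabs (u k) <= m k) -> ex_series m ->
  Rabs (Series u - sum_n u n) <= Series m - sum_n m n.
Proof.
  intros H Hm.
  assert (Hu : ex_series u) by (apply (ex_series_le u m); auto).
  assert (H1 := sum_n_le_Series (fun k => m k + u k) n
    ltac:(intros k; specialize (H k); apply Rabs_le_between in H; lra)
    (ex_series_plus m u Hm Hu)).
  assert (H2 := sum_n_le_Series (fun k => m k - u k) n
    ltac:(intros k; specialize (H k); apply Rabs_le_between in H; lra)
    (ex_series_minus m u Hm Hu)).
  rewrite Series_plus in H1 by auto. rewrite Series_minus in H2 by auto.
  assert (E : sum_n (fun k => m k + u k) n = sum_n m n + sum_n u n) by exact (sum_n_plus m u n).
  assert (E' : @eq R (sum_n (fun k => m k - u k) n) (sum_n m n - sum_n u n)).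
  { clear. induction n; [now rewrite !sum_O | rewrite !sum_n_Sn_R, IHn; ring]. }
  rewrite E in H1. rewrite E' in H2. apply Rabs_le; lra.
Qed.

Lemma Series_tail_small (m : nat -> R) (eps : R) :
  ex_series m -> 0 < eps -> eventually (fun n => Series m - sum_n m n < eps).
Proof.
  intros Hm He. apply Series_correct in Hm.
  change (is_lim_seq (sum_n m) (Series m)) in Hm.
  apply is_lim_seq_spec in Hm. specialize (Hm (mkposreal _ He)).
  eapply filter_imp; [|exact Hm]. simpl. intros n Hn. apply Rabs_def2 in Hn. lra.
Qed.

Lemma is_RInt_sum_n (f : nat -> R -> R) (p q : R) (v : nat -> R) (n : nat) :
  (forall k, is_RInt (f k) p q (v k)) ->
  is_RInt (fun x => sum_n (fun k => f k x) n) p q (sum_n v n).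
Proof.
  intros H. induction n as [|n IH].
  - rewrite sum_O. eapply is_RInt_ext; [|apply H]. intros; now rewrite sum_O.
  - rewrite sum_n_Sn_R. eapply is_RInt_ext; [|apply (is_RInt_plus _ _ _ _ _ _ IH (H (S n)))].
    intros x _. now rewrite sum_n_Sn_R.
Qed.

Lemma is_RInt_Series (f : nat -> R -> R) (m : nat -> R) (p q : R) :
  p <= q -> ex_series m ->
  (forall k x, p <= x <= q -> Rabs (f k x) <= m k) ->
  (forall k, ex_RInt (f k) p q) ->
  ex_RInt (fun x => Series (fun k => f k x)) p q /\
  is_series (fun k => RInt (f k) p q) (RInt (fun x => Series (fun k => f k x)) p q).
Proof.
  intros Hpq Hm Hf Hex.
  (* Clamping the argument to [p, q] turns uniform convergence on [p, q] into uniform convergence on R. *)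
  set (cl := fun x => Rmax p (Rmin x q)).
  assert (Hcl : forall x, p <= cl x <= q).
  { intros x. unfold cl, Rmax, Rmin. destruct (Rle_dec x q), (Rle_dec p _); lra. }
  assert (Hcl' : forall x, p <= x <= q -> cl x = x).
  { intros x Hx. unfold cl. now rewrite Rmin_left, Rmax_right by lra. }
  destruct (filterlim_RInt (V := R_CompleteNormedModule)
    (fun n x => sum_n (fun k => f k (cl x)) n) p q eventually _
    (fun x => Series (fun k => f k (cl x))) (sum_n (fun k => RInt (f k) p q))) as [v [Hv1 Hv2]].
  - intros n. apply (is_RInt_sum_n (fun k x => f k (cl x))).
    intros k. apply is_RInt_ext with (f k).
    + intros x Hx. rewrite Rmin_left, Rmax_right in Hx by lra. rewrite Hcl'; auto; lra.
    + apply (RInt_correct (f k)), Hex.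
  - intros P [eps HP]. unfold filtermap.
    eapply filter_imp; [|exact (Series_tail_small m eps Hm (cond_pos eps))].
    intros n Hn. apply HP. intros x.
    change (Rabs (sum_n (fun k => f k (cl x)) n - Series (fun k => f k (cl x))) < eps).
    rewrite Rabs_minus_sym.
    eapply Rle_lt_trans; [|exact Hn].
    apply (Series_tail_le (fun k => f k (cl x))); auto.
  - assert (Hv3 : is_RInt (fun x => Series (fun k => f k x)) p q v).
    { eapply is_RInt_ext; [|exact Hv2]. intros x Hx.
      rewrite Rmin_left, Rmax_right in Hx by lra. simpl. rewrite Hcl'; auto; lra. }
    split; [now exists v|]. rewrite (is_RInt_unique _ _ _ _ Hv3). exact Hv1.
Qed.

(** The majorant [m] may depend on the window and only justifies termwise integration there.
    Uniformity over all windows comes from [0 <= RInt (h k) x y <= beta k] and the summability of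
    [|c k| beta k]. *)
Lemma improper_Series (I : R -> Prop) (Fa Fb : (R -> Prop) -> Prop) (HE : exhausts I Fa Fb)
  (h : nat -> R -> R) (c beta : nat -> R) :
  (forall k x, I x -> continuous (h k) x) -> (forall k x, I x -> 0 <= h k x) ->
  (forall k, is_RInt_gen (h k) Fa Fb (beta k)) ->
  ex_series (fun k => Rabs (c k) * beta k) ->
  (forall p q, I p -> I q -> p <= q -> exists m : nat -> R, ex_series m /\
     forall k x, p <= x <= q -> Rabs (c k * h k x) <= m k) ->
  is_RInt_gen (fun x => Series (fun k => c k * h k x)) Fa Fb (Series (fun k => c k * beta k)).
Proof.
  intros Hc Hh Hb Hs Hm.
  assert (Hex : forall k p q, I p -> I q -> ex_RInt (h k) p q)
    by (intros; eapply ex_RInt_within; eauto).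
  assert (Hser : forall p q, I p -> I q -> p <= q ->
    ex_RInt (fun x => Series (fun k => c k * h k x)) p q /\
    is_series (fun k => c k * RInt (h k) p q) (RInt (fun x => Series (fun k => c k * h k x)) p q)).
  { intros p q Hp Hq Hpq. destruct (Hm p q Hp Hq Hpq) as [m [Hm1 Hm2]].
    destruct (is_RInt_Series (fun k x => c k * h k x) m p q Hpq Hm1 Hm2) as [H1 H2].
    - intros k. apply (ex_RInt_scal (h k) p q (c k)). auto.
    - split; [exact H1|]. eapply is_series_ext; [|exact H2]. intros k.
      apply (RInt_scal (h k) p q (c k)). auto. }
  assert (Hle : forall k x y, I x -> I y -> x <= y -> 0 <= RInt (h k) x y <= beta k).
  { intros k x y Hx Hy Hxy. split.
    - apply (RInt_nonneg_mono I Fa Fb HE (h k) x x y y); auto; lra.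
    - apply (RInt_le_improper I Fa Fb HE); auto. }
  assert (Hpart : forall n eps, 0 < eps -> exists p q, I p /\ I q /\ p <= q /\
     forall x y, I x -> I y -> x <= p -> q <= y ->
       Rabs (sum_n (fun k => c k * (RInt (h k) x y - beta k)) n) < eps).
  { assert (H1 : forall k eps, 0 < eps -> exists p q, I p /\ I q /\ p <= q /\
     forall x y, I x -> I y -> x <= p -> q <= y ->
       Rabs (c k * (RInt (h k) x y - beta k)) < eps).
    { intros k eps He. assert (Hk := Rabs_pos (c k)).
      assert (He' : 0 < eps / (Rabs (c k) + 1)) by (apply Rdiv_lt_0_compat; lra).
      destruct (improper_eventually I Fa Fb HE (h k) (beta k) (Hc k) (Hh k) (Hb k) _ He')
        as (p & q & Hp & Hq & Hpq & H).
      exists p, q. repeat split; auto. intros x y Hx Hy Hxp Hqy.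
      specialize (H x y Hx Hy Hxp Hqy). rewrite Rabs_mult.
      apply Rle_lt_trans with (Rabs (c k) * (eps / (Rabs (c k) + 1))).
      - apply Rmult_le_compat_l; lra.
      - assert (E : eps = (Rabs (c k) + 1) * (eps / (Rabs (c k) + 1))) by (field; lra). lra. }
    induction n as [|n IH]; intros eps He.
    - destruct (H1 0%nat eps He) as (p & q & Hp & Hq & Hpq & H).
      exists p, q. repeat split; auto. intros. rewrite sum_O. auto.
    - destruct (IH (eps / 2) ltac:(lra)) as (p & q & Hp & Hq & Hpq & H).
      destruct (H1 (S n) (eps / 2) ltac:(lra)) as (p' & q' & Hp' & Hq' & Hpq' & H').
      exists (Rmin p p'), (Rmax q q'). repeat split.
      + unfold Rmin; destruct Rle_dec; auto.
      + unfold Rmax; destruct Rle_dec; auto.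
      + generalize (Rmin_l p p') (Rmax_l q q'); lra.
      + intros x y Hx Hy Hxp Hqy. rewrite sum_n_Sn_R.
        generalize (Rmin_l p p') (Rmax_l q q') (Rmin_r p p') (Rmax_r q q'); intros.
        specialize (H x y Hx Hy ltac:(lra) ltac:(lra)).
        specialize (H' x y Hx Hy ltac:(lra) ltac:(lra)).
        eapply Rle_lt_trans; [apply Rabs_triang|]. lra. }
  apply (is_RInt_gen_intro I Fa Fb HE).
  { intros p q Hp Hq Hpq. now apply Hser. }
  intros eps He.
  (* The cut-off [n] is fixed first and serves every window; the window is then chosen for the
     finitely many remaining terms. *)
  destruct (Series_tail_small _ (eps / 2) Hs ltac:(lra)) as [n Hn].
  specialize (Hn n (Nat.le_refl n)).
  destruct (Hpart n (eps / 2) ltac:(lra)) as (p & q & Hp & Hq & Hpq & H).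
  exists p, q. repeat split; auto. intros x y Hx Hy Hxp Hqy.
  specialize (H x y Hx Hy Hxp Hqy).
  assert (Hxy : x <= y) by lra.
  destruct (Hser x y Hx Hy Hxy) as [_ Hsum].
  assert (Hcb : ex_series (fun k => c k * beta k)).
  { apply (ex_series_le (fun k => c k * beta k) (fun k => Rabs (c k) * beta k)); auto.
    intros k. change (Rabs (c k * beta k) <= Rabs (c k) * beta k).
    rewrite Rabs_mult, (Rabs_pos_eq (beta k)); [lra|]. specialize (Hle k x y Hx Hy Hxy); lra. }
  rewrite <- (is_series_unique _ _ Hsum).
  rewrite <- Series_minus by (auto; eexists; exact Hsum).
  assert (E : Series (fun k => c k * RInt (h k) x y - c k * beta k)
            = Series (fun k => c k * (RInt (h k) x y - beta k)))
    by (apply Series_ext; intros; ring).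
  rewrite E.
  assert (Ht : Rabs (Series (fun k => c k * (RInt (h k) x y - beta k))
                     - sum_n (fun k => c k * (RInt (h k) x y - beta k)) n)
               <= Series (fun k => Rabs (c k) * beta k) - sum_n (fun k => Rabs (c k) * beta k) n).
  { apply Series_tail_le; auto. intros k. rewrite Rabs_mult.
    apply Rmult_le_compat_l; [apply Rabs_pos|].
    specialize (Hle k x y Hx Hy Hxy). apply Rabs_le; lra. }
  apply Rabs_def2 in H. apply Rabs_le_between in Ht. apply Rabs_def1; lra.
Qed.

(** * Gauss's summation of 2F1 at 1 *)

Lemma eventually_INR_gt (M : R) : eventually (fun n => M < INR n).
Proof. exact (proj2 (is_lim_seq_spec INR p_infty) is_lim_seq_INR M). Qed.

Lemma poch_pos (x : R) (k : nat) : 0 < x -> 0 < poch x k.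
Proof.
  intros Hx. induction k as [|k IH]; simpl; [lra|].
  apply Rmult_lt_0_compat; auto. generalize (pos_INR k); lra.
Qed.

Lemma poch_shift (x : R) (k : nat) : x * poch (x + 1) k = poch x k * (x + INR k).
Proof.
  induction k as [|k IH]; [simpl; ring|].
  change (poch (x + 1) (S k)) with (poch (x + 1) k * (x + 1 + INR k)).
  change (poch x (S k)) with (poch x k * (x + INR k)).
  rewrite <- Rmult_assoc, IH, S_INR. ring.
Qed.

Lemma INR_fact_pos (k : nat) : 0 < INR (fact k).
Proof. apply lt_0_INR, lt_O_fact. Qed.

Definition gauss_term (A B C : R) (j : nat) : R :=
  poch A j * poch B j / (poch C j * INR (fact j)).

Lemma gauss_term_S (A B C : R) (j : nat) : 0 < C ->
  gauss_term A B C (S j) = (A + INR j) * (B + INR j) / ((C + INR j) * INR (S j)) * gauss_term A B C j.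
Proof.
  intros HC. unfold gauss_term.
  assert (H1 := poch_pos C j HC). assert (H2 := INR_fact_pos j). assert (H3 := pos_INR j).
  change (fact (S j)) with (S j * fact j)%nat. rewrite mult_INR.
  assert (H4 : 0 < INR (S j)) by (rewrite S_INR; lra).
  simpl poch. field. repeat split; lra.
Qed.

(** Source of both the convergence test and the contiguous relation: a rational multiple of the j-th
    term is a difference of consecutive values of [j t_j]. *)
Lemma gauss_term_telescope (A B C : R) (j : nat) : 0 < C ->
  INR j * gauss_term A B C j - INR (S j) * gauss_term A B C (S j)
  = ((C - A - B) * INR j - A * B) / (C + INR j) * gauss_term A B C j.
Proof.
  intros HC. rewrite gauss_term_S by auto. assert (H := pos_INR j).
  rewrite S_INR. field. lra.
Qed.

Lemma gauss_term_incr_C (A B C : R) (j : nat) : 0 < C ->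
  gauss_term A B (C + 1) j = C / (C + INR j) * gauss_term A B C j.
Proof.
  intros HC. unfold gauss_term.
  assert (H1 := poch_pos C j HC). assert (H2 := INR_fact_pos j). assert (H3 := pos_INR j).
  assert (H4 := poch_pos (C + 1) j ltac:(lra)).
  assert (E : poch C j = C * poch (C + 1) j / (C + INR j)).
  { rewrite poch_shift. field. lra. }
  rewrite E. field. repeat split; lra.
Qed.

(** The partial sums dominate a logarithm, since ln (1 + x) <= x at x = 1/(n+1) bounds each
    increment. *)
Lemma harmonic_diverges : ~ ex_series (fun k => / INR (S k)).
Proof.
  intros H.
  assert (Hpos : forall k, 0 <= / INR (S k)).
  { intros k. apply Rlt_le, Rinv_0_lt_compat, lt_0_INR; lia. }
  assert (Hln : forall n, ln (INR (S (S n))) <= sum_n (fun k => / INR (S k)) n).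
  { assert (Hstep : forall n, ln (INR (S (S n))) - ln (INR (S n)) <= / INR (S n)).
    { intros n. assert (Hn : 0 < INR (S n)) by (apply lt_0_INR; lia).
      assert (E : INR (S (S n)) = INR (S n) * (1 + / INR (S n))).
      { rewrite (S_INR (S n)). field. lra. }
      assert (Hi := Rinv_0_lt_compat _ Hn).
      rewrite E, ln_mult by lra.
      assert (Hl : ln (1 + / INR (S n)) <= / INR (S n)).
      { rewrite <- (ln_exp (/ INR (S n))) at 2. apply ln_le; [lra|]. apply exp_ineq1_le. }
      lra. }
    induction n as [|n IH].
    - rewrite sum_O. specialize (Hstep 0%nat). simpl in Hstep |- *. rewrite ln_1 in Hstep. lra.
    - rewrite sum_n_Sn_R. specialize (Hstep (S n)). lra. }
  destruct (eventually_INR_gt (exp (Series (fun k => / INR (S k))))) as [n Hn].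
  specialize (Hn n (Nat.le_refl n)).
  assert (H1 := sum_n_le_Series _ n Hpos H). specialize (Hln n).
  assert (H2 : exp (ln (INR (S (S n)))) <= exp (Series (fun k => / INR (S k)))).
  { destruct (Rle_lt_or_eq_dec _ _ (Rle_trans _ _ _ Hln H1)) as [Hl|He].
    - left. now apply exp_increasing.
    - right. now rewrite He. }
  rewrite exp_ln in H2 by (apply lt_0_INR; lia). rewrite !S_INR in H2. lra.
Qed.

Lemma is_series_telescope (v : nat -> R) (l : R) :
  is_lim_seq v l -> is_series (fun k => v k - v (S k)) (v 0%nat - l).
Proof.
  intros H. change (is_lim_seq (sum_n (fun k => v k - v (S k))) (v 0%nat - l)).
  apply is_lim_seq_ext with (fun n => v 0%nat - v (S n)).
  - intros n. induction n as [|n IH]; [now rewrite sum_O|].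
    rewrite sum_n_Sn_R, <- IH. ring.
  - apply (is_lim_seq_minus' (fun _ => v 0%nat) (fun n => v (S n))).
    + apply is_lim_seq_const.
    + now apply is_lim_seq_incr_1 in H.
Qed.

(* Raabe's test: [j |t_j|] is eventually decreasing, with decrements at least [(C-A-B)/2 |t_j|]. *)
Lemma gauss_summable (A B C : R) : 0 < C -> 0 < C - A - B ->
  ex_series (fun j => Rabs (gauss_term A B C j)) /\
  is_lim_seq (fun j => INR j * gauss_term A B C j) 0.
Proof.
  intros HC Hs. set (s := C - A - B) in *. set (t := gauss_term A B C).
  set (u := fun j => INR j * Rabs (t j)).
  assert (Hu0 : forall j, 0 <= u j) by (intros; apply Rmult_le_pos; [apply pos_INR|apply Rabs_pos]).
  (* Beyond [J] the factors A + j and B + j are nonnegative, so absolute values pass through the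
     term ratio, and j >= 2AB/s + C is exactly the inequality s/2 (C + j) <= s j - AB. *)
  destruct (eventually_INR_gt (1 + Rabs A + Rabs B + Rabs (2 * (A * B) / s + C))) as [J HJ].
  assert (HJ1 : forall j, (J <= j)%nat -> 1 < INR j /\ 0 <= A + INR j /\ 0 <= B + INR j /\
     s / 2 * (C + INR j) <= s * INR j - A * B).
  { intros j Hj. specialize (HJ j Hj).
    assert (H1 := Rabs_pos A). assert (H2 := Rabs_pos B).
    assert (H3 := Rabs_pos (2 * (A * B) / s + C)).
    assert (H4 := Rle_abs (- A)). assert (H5 := Rle_abs (- B)). rewrite Rabs_Ropp in H4, H5.
    assert (H6 := Rle_abs (2 * (A * B) / s + C)).
    repeat split; try lra.
    assert (E : s / 2 * (C + INR j) = s * INR j - A * B - s / 2 * (INR j - (2 * (A * B) / s + C)))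
      by (field; lra).
    assert (0 <= s / 2 * (INR j - (2 * (A * B) / s + C))) by (apply Rmult_le_pos; lra). lra. }
  assert (Hdec : forall j, (J <= j)%nat -> s / 2 * Rabs (t j) <= u j - u (S j)).
  { intros j Hj. destruct (HJ1 j Hj) as (Hj1 & HA & HB & Hq).
    assert (E : u j - u (S j) = (s * INR j - A * B) / (C + INR j) * Rabs (t j)).
    { unfold u, t. rewrite gauss_term_S by auto.
      rewrite (Rabs_mult (_ / _)), (Rabs_pos_eq (_ / _)).
      - rewrite S_INR. unfold s. field. assert (Hn := pos_INR j). lra.
      - apply Rmult_le_pos; [now apply Rmult_le_pos|].
        apply Rlt_le, Rinv_0_lt_compat, Rmult_lt_0_compat; rewrite ?S_INR; lra. }
    rewrite E. apply Rmult_le_compat_r; [apply Rabs_pos|].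
    apply (proj1 (Rle_div_r _ _ (C + INR j) ltac:(lra))). exact Hq. }
  set (v := fun k => u (J + k)%nat).
  assert (Hv : forall k, v (S k) <= v k).
  { intros k. unfold v. rewrite Nat.add_succ_r.
    specialize (Hdec (J + k)%nat ltac:(lia)).
    assert (H := Rabs_pos (t (J + k)%nat)).
    assert (0 <= s / 2 * Rabs (t (J + k)%nat)) by (apply Rmult_le_pos; lra). lra. }
  destruct (ex_finite_lim_seq_decr v 0 Hv (fun k => Hu0 _)) as [l Hl].
  assert (Hsum : ex_series (fun j => Rabs (t j))).
  { apply (ex_series_incr_n _ J).
    apply (ex_series_le (fun k => Rabs (t (J + k)%nat)) (fun k => 2 / s * (v k - v (S k)))).
    - intros k. change (Rabs (Rabs (t (J + k)%nat)) <= 2 / s * (v k - v (S k))).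
      rewrite Rabs_Rabsolu. unfold v. rewrite Nat.add_succ_r.
      specialize (Hdec (J + k)%nat ltac:(lia)).
      apply Rmult_le_reg_l with (s / 2); [lra|].
      replace (s / 2 * (2 / s * (u (J + k)%nat - u (S (J + k))))) with (u (J + k)%nat - u (S (J + k))) by (field; lra).
      exact Hdec.
    - apply (ex_series_scal_l (2 / s) (fun k => v k - v (S k))).
      exists (v 0%nat - l). now apply is_series_telescope. }
  split; [exact Hsum|].
  assert (Hlim : is_lim_seq u l) by (apply (is_lim_seq_incr_n u J), (is_lim_seq_ext v); auto;
    intros; unfold v; f_equal; lia).
  assert (Hl0 : 0 <= l) by (apply (is_lim_seq_le (fun _ => 0) u 0 l); auto; apply is_lim_seq_const).
  assert (Hge : forall k, l <= v k) by (intros; now apply (is_lim_seq_decr_compare v)).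
  destruct (Rle_lt_or_eq_dec _ _ Hl0) as [Hpos|<-].
  (* A positive limit [l] would be a lower bound for j |t_j|, so the summable |t_j| would dominate
     l/j. *)
  - exfalso. apply harmonic_diverges.
    apply (ex_series_incr_1 (fun k => / INR k)), (ex_series_incr_n _ J).
    apply (ex_series_le (fun k => / INR (J + k)) (fun k => / l * Rabs (t (J + k)%nat))).
    + intros k. change (Rabs (/ INR (J + k)) <= / l * Rabs (t (J + k)%nat)).
      destruct (HJ1 (J + k)%nat ltac:(lia)) as (Hj1 & _).
      rewrite Rabs_pos_eq by (apply Rlt_le, Rinv_0_lt_compat; lra).
      specialize (Hge k). unfold v, u in Hge.
      apply Rmult_le_reg_l with (l * INR (J + k)); [apply Rmult_lt_0_compat; lra|].
      replace (l * INR (J + k) * / INR (J + k)) with l by (field; lra).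
      replace (l * INR (J + k) * (/ l * Rabs (t (J + k)%nat))) with (INR (J + k) * Rabs (t (J + k)%nat))
        by (field; lra). exact Hge.
    + apply (ex_series_scal_l (/ l) (fun k => Rabs (t (J + k)%nat))). now apply (ex_series_incr_n _ J) in Hsum.
  - apply is_lim_seq_abs_0. apply (is_lim_seq_ext u); auto.
    intros j. rewrite Rabs_mult, (Rabs_pos_eq (INR j)); [reflexivity|apply pos_INR].
Qed.

(** The termwise difference of the two sides is (s j - AB)/(C + j) t_j with s = C - A - B, that is,
    the telescoping difference; its sum is 0 because [j t_j] vanishes at j = 0 and in the limit. *)
Lemma gauss_contiguous (A B C : R) : 0 < C -> 0 < C - A - B ->
  (C - A - B) * Series (gauss_term A B C)
  = (C - A) * (C - B) / C * Series (gauss_term A B (C + 1)).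
Proof.
  intros HC Hs.
  destruct (gauss_summable A B C HC Hs) as [H1 H2].
  destruct (gauss_summable A B (C + 1) ltac:(lra) ltac:(lra)) as [H3 _].
  apply ex_series_Rabs in H1. apply ex_series_Rabs in H3.
  apply is_series_telescope, is_series_unique in H2. simpl INR in H2 at 3.
  rewrite Rmult_0_l, Rminus_0_r in H2.
  apply Rminus_diag_uniq. rewrite <- !Series_scal_l, <- Series_minus.
  - etransitivity; [|exact H2]. apply Series_ext. intros j.
    rewrite gauss_term_telescope, gauss_term_incr_C by auto.
    assert (H := pos_INR j). field. lra.
  - now apply (ex_series_scal_l (C - A - B) (gauss_term A B C)).
  - now apply (ex_series_scal_l ((C - A) * (C - B) / C) (gauss_term A B (C + 1))).
Qed.

(** The index starts at 1 because the 0-th term is 1 for every lower parameter. The first term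
    supplies the factor C/(C+k), and each later ratio only shrinks when the lower parameter
    grows. *)
Lemma gauss_term_decr_C (A B C : R) (k j : nat) : 0 < C ->
  Rabs (gauss_term A B (C + INR k) (S j)) <= C / (C + INR k) * Rabs (gauss_term A B C (S j)).
Proof.
  intros HC. assert (Hk := pos_INR k). induction j as [|j IH].
  - unfold gauss_term. simpl. rewrite <- Rabs_pos_eq with (C / (C + INR k)), <- Rabs_mult.
    + right. f_equal. field. lra.
    + apply Rlt_le, Rdiv_lt_0_compat; lra.
  - rewrite (gauss_term_S A B (C + INR k) (S j)), (gauss_term_S A B C (S j)) by lra.
    rewrite 2 (Rabs_mult (_ / _)), !(Rmult_comm (Rabs (_ / _))).
    rewrite <- Rmult_assoc. assert (Hj := pos_INR (S j)).
    assert (HS : 0 < INR (S (S j))) by (rewrite S_INR; lra).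
    apply Rmult_le_compat; try apply Rabs_pos; auto.
    unfold Rdiv. rewrite !(Rabs_mult (_ * _)).
    apply Rmult_le_compat_l; [apply Rabs_pos|].
    rewrite !Rabs_pos_eq by (apply Rlt_le, Rinv_0_lt_compat, Rmult_lt_0_compat; lra).
    apply Rinv_le_contravar; [apply Rmult_lt_0_compat; lra|].
    apply Rmult_le_compat_r; lra.
Qed.

(** Everything beyond the initial 1 is at most C/(C+k) times a fixed convergent sum. *)
Lemma gauss_series_shift_lim (A B C : R) : 0 < C -> 0 < C - A - B ->
  is_lim_seq (fun k => Series (gauss_term A B (C + INR k))) 1.
Proof.
  intros HC Hs. destruct (gauss_summable A B C HC Hs) as [H0 _].
  assert (H1 : ex_series (fun j => Rabs (gauss_term A B C (S j)))) by now apply ex_series_incr_1 in H0.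
  set (M := Series (fun j => Rabs (gauss_term A B C (S j)))) in *.
  assert (Hb : forall k, Rabs (Series (gauss_term A B (C + INR k)) - 1) <= C / (C + INR k) * M).
  { intros k. assert (Hk := pos_INR k).
    destruct (gauss_summable A B (C + INR k) ltac:(lra) ltac:(lra)) as [H2 _].
    assert (H3 : ex_series (fun j => Rabs (gauss_term A B (C + INR k) (S j))))
      by now apply ex_series_incr_1 in H2.
    rewrite Series_incr_1 by now apply ex_series_Rabs.
    replace (gauss_term A B (C + INR k) 0) with 1 by (unfold gauss_term; simpl; field).
    replace (1 + Series (fun j => gauss_term A B (C + INR k) (S j)) - 1)
      with (Series (fun j => gauss_term A B (C + INR k) (S j))) by ring.
    eapply Rle_trans; [now apply Series_Rabs|].
    unfold M. rewrite <- Series_scal_l. apply Series_le.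
    - intros j. split; [apply Rabs_pos|]. now apply gauss_term_decr_C.
    - now apply (ex_series_scal_l (C / (C + INR k)) (fun j => Rabs (gauss_term A B C (S j)))). }
  assert (Hlim : is_lim_seq (fun k => C / (C + INR k) * M) 0).
  { replace 0 with (C * 0 * M) by ring.
    apply (is_lim_seq_mult' (fun k => C / (C + INR k)) (fun _ => M)); [|apply is_lim_seq_const].
    apply (is_lim_seq_mult' (fun _ => C) (fun k => / (C + INR k))); [apply is_lim_seq_const|].
    apply (is_lim_seq_inv _ p_infty); [|discriminate].
    apply (is_lim_seq_plus _ _ C p_infty); [apply is_lim_seq_const|apply is_lim_seq_INR|reflexivity]. }
  apply (is_lim_seq_le_le (fun k => 1 - C / (C + INR k) * M) _ (fun k => 1 + C / (C + INR k) * M)).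
  - intros k. specialize (Hb k). apply Rabs_le_between in Hb. lra.
  - replace 1 with (1 - 0) at 1 by ring. apply (is_lim_seq_minus' (fun _ => 1)); auto. apply is_lim_seq_const.
  - replace 1 with (1 + 0) at 1 by ring. apply (is_lim_seq_plus' (fun _ => 1)); auto. apply is_lim_seq_const.
Qed.

(** Gauss's theorem with the Gamma quotient still in product-limit form: [k] applications of the
    contiguous relation extract the Pochhammer quotient, and the series left over tends to 1. *)
Lemma gauss_summation_limit (A B C : R) : 0 < C -> 0 < C - A - B ->
  is_lim_seq (fun k => poch (C - A) k * poch (C - B) k / (poch C k * poch (C - A - B) k))
    (Series (gauss_term A B C)).
Proof.
  intros HC Hs.
  assert (Hrec : forall k, Series (gauss_term A B C) =
    poch (C - A) k * poch (C - B) k / (poch C k * poch (C - A - B) k)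
    * Series (gauss_term A B (C + INR k))).
  { induction k as [|k IH].
    - simpl. rewrite Rplus_0_r. field.
    - rewrite IH. assert (Hk := pos_INR k).
      assert (H := gauss_contiguous A B (C + INR k) ltac:(lra) ltac:(lra)).
      rewrite S_INR, <- Rplus_assoc.
      assert (E : Series (gauss_term A B (C + INR k)) =
        (C - A + INR k) * (C - B + INR k) / ((C + INR k) * (C - A - B + INR k))
        * Series (gauss_term A B (C + INR k + 1))).
      { apply Rmult_eq_reg_l with (C + INR k - A - B); [|lra]. rewrite H. field. lra. }
      rewrite E. simpl poch.
      assert (H1 := poch_pos C k HC). assert (H2 := poch_pos (C - A - B) k Hs).
      field. lra. }
  assert (Hlim := gauss_series_shift_lim A B C HC Hs).
  (* Solving for the Pochhammer quotient divides by the shifted series, which is nonzero once it is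
     within 1/2 of its limit 1. *)
  apply is_lim_seq_ext_loc with (fun k => Series (gauss_term A B C) / Series (gauss_term A B (C + INR k))).
  - apply is_lim_seq_spec in Hlim.
    eapply filter_imp; [|exact (Hlim (mkposreal (1/2) ltac:(lra)))].
    simpl. intros k Hk. apply Rabs_def2 in Hk. rewrite (Hrec k) at 1.
    field. repeat split.
    + apply Rgt_not_eq, poch_pos; lra.
    + apply Rgt_not_eq, poch_pos; lra.
    + lra.
  - replace (Finite (Series (gauss_term A B C))) with (Finite (Series (gauss_term A B C) / 1)) by (f_equal; field).
    apply (is_lim_seq_div' (fun _ => Series (gauss_term A B C))); [apply is_lim_seq_const|exact Hlim|lra].
Qed.

(** * The Gamma function *)

(** The integral of [g] over a window is [G q - G p], hence at most [2 M], and monotone convergence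
    applies to [f]. *)
Lemma improper_exists_dominated (I : R -> Prop) (Fa Fb : (R -> Prop) -> Prop)
  (HE : exhausts I Fa Fb) (f g G : R -> R) (M : R) :
  (forall z, I z -> continuous f z) -> (forall z, I z -> 0 <= f z <= g z) ->
  (forall z, I z -> is_derive G z (g z)) -> (forall z, I z -> continuous g z) ->
  (forall z, I z -> Rabs (G z) <= M) ->
  exists L, is_RInt_gen f Fa Fb L.
Proof.
  intros Hf Hfg HG Hg HM.
  apply (improper_exists I Fa Fb HE f (M + M)); auto.
  { intros z Hz; now apply Hfg. }
  intros p q Hp Hq Hpq.
  assert (Hin : forall z, p <= z <= q -> I z) by (intros; now apply (exh_convex _ _ _ HE p q)).
  assert (Hd : is_RInt g p q (G q - G p)).
  { apply (is_RInt_derive G g); rewrite Rmin_left, Rmax_right by lra; auto. }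
  apply Rle_trans with (G q - G p).
  - apply (is_RInt_le f g p q _ _ Hpq); auto.
    + apply (RInt_correct f). now apply (ex_RInt_within I Fa Fb HE).
    + intros x Hx. apply Hfg, Hin; lra.
  - generalize (HM p Hp) (HM q Hq). intros H1 H2.
    apply Rabs_le_between in H1. apply Rabs_le_between in H2. lra.
Qed.

(** * Real powers: derivatives, bounds and limits at the ends *)

Lemma Rpower_pos (x y : R) : 0 < Rpower x y.
Proof. apply exp_pos. Qed.

Lemma Rpower_succ (x y : R) : 0 < x -> Rpower x (y + 1) = Rpower x y * x.
Proof. intros Hx. now rewrite Rpower_plus, Rpower_1. Qed.

Lemma is_derive_Rpower (x y : R) : 0 < x ->
  is_derive (fun t => Rpower t y) x (y * Rpower x (y - 1)).
Proof. intros. now apply is_derive_Reals, derivable_pt_lim_power. Qed.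

Lemma is_derive_Rpower_1m (x y : R) : x < 1 ->
  is_derive (fun t => Rpower (1 - t) y) x (- (y * Rpower (1 - x) (y - 1))).
Proof.
  intros Hx.
  replace (- (y * Rpower (1 - x) (y - 1))) with (scal (-1) (y * Rpower (1 - x) (y - 1)))
    by (unfold scal; simpl; unfold mult; simpl; ring).
  apply (is_derive_comp (fun t => Rpower t y) (fun t => 1 - t)).
  - apply is_derive_Rpower; lra.
  - auto_derive; auto; ring.
Qed.

Lemma continuous_Rpower (x y : R) : 0 < x -> continuous (fun t => Rpower t y) x.
Proof.
  intros. apply (ex_derive_continuous (fun t => Rpower t y)).
  exists (y * Rpower x (y - 1)). now apply is_derive_Rpower.
Qed.

Lemma continuous_Rpower_1m (x y : R) : x < 1 -> continuous (fun t => Rpower (1 - t) y) x.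
Proof.
  intros. apply (ex_derive_continuous (fun t => Rpower (1 - t) y)).
  exists (- (y * Rpower (1 - x) (y - 1))). now apply is_derive_Rpower_1m.
Qed.

Lemma Rpower_small (a eps : R) : 0 < a -> 0 < eps ->
  exists eta, 0 < eta /\ forall x, 0 < x < eta -> Rpower x a < eps.
Proof.
  intros Ha He. exists (Rpower eps (/ a)). split; [apply Rpower_pos|].
  intros x Hx. replace eps with (Rpower (Rpower eps (/ a)) a).
  - apply Rlt_Rpower_l; lra.
  - rewrite Rpower_mult. replace (/ a * a) with 1 by (field; lra). now apply Rpower_1.
Qed.

(** One bound for both signs of the exponent: [- Rabs e] gives the larger of the two powers, taken
    at the worst point [p]. *)
Lemma Rpower_le_abs (p x e : R) : 0 < p -> p <= x <= 1 -> Rpower x e <= Rpower p (- Rabs e).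
Proof.
  intros Hp Hx. unfold Rpower.
  assert (H1 : ln p <= ln x) by (apply ln_le; lra).
  assert (H2 : ln x <= 0) by (rewrite <- ln_1; apply ln_le; lra).
  assert (H : e * ln x <= - Rabs e * ln p).
  { apply Rle_trans with (Rabs e * - ln x).
    - generalize (Rle_abs (- e)); rewrite Rabs_Ropp; intros H3.
      assert (0 <= (Rabs e + e) * - ln x) by (apply Rmult_le_pos; lra). lra.
    - assert (0 <= Rabs e * (ln x - ln p)) by (apply Rmult_le_pos; [apply Rabs_pos|lra]). lra. }
  destruct H as [H|H]; [left; now apply exp_increasing|right; now rewrite H].
Qed.

Lemma Rpower_le_1 (x e : R) : 0 < x <= 1 -> 0 <= e -> Rpower x e <= 1.
Proof.
  intros Hx He. rewrite <- exp_0. unfold Rpower.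
  assert (H2 : ln x <= 0) by (rewrite <- ln_1; apply ln_le; lra).
  assert (H : e * ln x <= 0) by (assert (0 <= e * - ln x) by (apply Rmult_le_pos; lra); lra).
  destruct H as [H|H]; [left; now apply exp_increasing|right; now rewrite H].
Qed.

Lemma filterlim_0_right (F : R -> R) (a : R) : 0 < a ->
  (forall x, 0 < x < 1 -> Rabs (F x) <= Rpower x a) ->
  filterlim F (at_right 0) (locally 0).
Proof.
  intros Ha HF P [eps HP].
  destruct (Rpower_small a eps Ha (cond_pos eps)) as (eta & He & H).
  assert (Hm : 0 < Rmin eta 1) by (apply Rmin_pos; lra).
  exists (mkposreal _ Hm). intros x Hx Hx0. apply HP.
  change (Rabs (x - 0) < Rmin eta 1) in Hx. change (Rabs (F x - 0) < eps).
  rewrite Rminus_0_r in *. apply Rabs_def2 in Hx.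
  generalize (Rmin_l eta 1) (Rmin_r eta 1); intros.
  apply Rle_lt_trans with (Rpower x a); [apply HF|apply H]; lra.
Qed.

Lemma filterlim_0_left (F : R -> R) (a : R) : 0 < a ->
  (forall x, 0 < x < 1 -> Rabs (F x) <= Rpower (1 - x) a) ->
  filterlim F (at_left 1) (locally 0).
Proof.
  intros Ha HF P [eps HP].
  destruct (Rpower_small a eps Ha (cond_pos eps)) as (eta & He & H).
  assert (Hm : 0 < Rmin eta 1) by (apply Rmin_pos; lra).
  exists (mkposreal _ Hm). intros x Hx Hx0. apply HP.
  change (Rabs (x - 1) < Rmin eta 1) in Hx. change (Rabs (F x - 0) < eps).
  rewrite Rminus_0_r in *. apply Rabs_def2 in Hx.
  generalize (Rmin_l eta 1) (Rmin_r eta 1); intros.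
  apply Rle_lt_trans with (Rpower (1 - x) a); [apply HF|apply H]; lra.
Qed.

Lemma filterlim_0_infty (F : R -> R) (K : R) :
  (forall x, 0 < x -> Rabs (F x) <= K / x) ->
  filterlim F (Rbar_locally p_infty) (locally 0).
Proof.
  intros HF P [eps HP]. assert (He := cond_pos eps).
  exists (Rmax 1 (K / eps)). intros x Hx. apply HP.
  generalize (Rmax_l 1 (K / eps)) (Rmax_r 1 (K / eps)); intros H1 H2.
  change (Rabs (F x - 0) < eps). rewrite Rminus_0_r.
  eapply Rle_lt_trans; [apply HF; lra|].
  apply Rlt_div_l; [lra|].
  assert (H3 : K / eps * eps < x * eps) by (apply Rmult_lt_compat_r; lra).
  replace (K / eps * eps) with K in H3 by (field; lra). lra.
Qed.

(** * Euler's Gamma integral and its functional equation *)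

Definition gamma_int (s t : R) : R := Rpower t (s - 1) * exp (- t).

Lemma gamma_int_pos (s t : R) : 0 < gamma_int s t.
Proof. apply Rmult_lt_0_compat; [apply Rpower_pos|apply exp_pos]. Qed.

Lemma continuous_gamma_int (s t : R) : half_line t -> continuous (gamma_int s) t.
Proof.
  intros Ht. apply (continuous_mult (fun t => Rpower t (s - 1)) (fun t => exp (- t))).
  - now apply continuous_Rpower.
  - apply (ex_derive_continuous (fun t => exp (- t))). auto_derive. auto.
Qed.

(** The constant comes from the tangent of ln at [m]: ln y <= y/m - 1 + ln m with y = 1 + t cancels
    the [- t] in the exponent. *)
Lemma Rpower_exp_bound (m : R) : 0 < m ->
  exists K, 0 < K /\ forall t, 0 < t -> Rpower (1 + t) m * exp (- t) <= K.
Proof.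
  intros Hm. exists (exp (1 - m + m * ln m)). split; [apply exp_pos|].
  intros t Ht. unfold Rpower. rewrite <- exp_plus.
  assert (H : ln (1 + t) <= (1 + t) / m - 1 + ln m).
  { replace (1 + t) with ((1 + t) / m * m) at 1 by (field; lra).
    assert (H1 : 0 < (1 + t) / m) by (apply Rdiv_lt_0_compat; lra).
    rewrite ln_mult by lra.
    assert (H2 : ln ((1 + t) / m) <= (1 + t) / m - 1).
    { rewrite <- (ln_exp ((1 + t) / m - 1)). apply ln_le; auto.
      generalize (exp_ineq1_le ((1 + t) / m - 1)). lra. }
    lra. }
  assert (H3 : m * ln (1 + t) <= m * ((1 + t) / m - 1 + ln m)) by (apply Rmult_le_compat_l; lra).
  replace (m * ((1 + t) / m - 1 + ln m)) with (1 + t - m + m * ln m) in H3 by (field; lra).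
  assert (H4 : m * ln (1 + t) + - t <= 1 - m + m * ln m) by lra.
  destruct H4 as [H4|H4]; [left; now apply exp_increasing|right; now rewrite H4].
Qed.

Lemma is_RInt_gen_gamma (s : R) : 0 < s ->
  is_RInt_gen (gamma_int s) (at_right 0) (Rbar_locally p_infty) (GammaPos s).
Proof.
  intros Hs.
  destruct (Rpower_exp_bound (s + 1) ltac:(lra)) as (K & HK & HKt).
  (* [t^(s-1) (1+t)^(-s-1)] is the derivative of the bounded function [(t/(1+t))^s / s]. *)
  destruct (improper_exists_dominated half_line _ _ exhausts_half_line (gamma_int s)
    (fun t => K * (Rpower t (s - 1) * Rpower (1 + t) (- s - 1)))
    (fun t => K / s * (Rpower t s * Rpower (1 + t) (- s))) (K / s)) as [L HL].
  - intros; now apply continuous_gamma_int.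
  - unfold half_line. intros t Ht. split; [apply Rlt_le, gamma_int_pos|].
    unfold gamma_int. rewrite Rmult_comm, (Rmult_comm (Rpower t _)), <- Rmult_assoc.
    apply Rmult_le_compat_r; [apply Rlt_le, Rpower_pos|].
    replace (- s - 1) with (- (s + 1)) by ring. rewrite Rpower_Ropp.
    apply (proj1 (Rle_div_r _ _ _ (Rpower_pos (1 + t) (s + 1)))).
    rewrite Rmult_comm. now apply HKt.
  - unfold half_line. intros t Ht.
    assert (D2 : is_derive (fun t => Rpower (1 + t) (- s)) t (- s * Rpower (1 + t) (- s - 1))).
    { replace (- s * Rpower (1 + t) (- s - 1)) with (scal 1 (- s * Rpower (1 + t) (- s - 1)))
        by (unfold scal; simpl; unfold mult; simpl; ring).
      apply (is_derive_comp (fun t => Rpower t (- s)) (fun t => 1 + t)).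
      - apply is_derive_Rpower; lra.
      - auto_derive; auto; ring. }
    assert (D := is_derive_mult _ _ _ _ _ (is_derive_Rpower t s Ht) D2 Rmult_comm).
    apply (is_derive_scal _ t (K / s)) in D.
    match type of D with is_derive _ _ ?d => replace (K * (Rpower t (s - 1) * Rpower (1 + t) (- s - 1))) with d end.
    + exact D.
    + unfold plus, mult; simpl.
      replace (Rpower t s) with (Rpower t (s - 1) * t)
        by (rewrite <- Rpower_succ by auto; f_equal; ring).
      replace (Rpower (1 + t) (- s)) with (Rpower (1 + t) (- s - 1) * (1 + t))
        by (rewrite <- Rpower_succ by lra; f_equal; ring).
      field. lra.
  - unfold half_line. intros t Ht.
    apply (continuous_scal_r K (fun t => Rpower t (s - 1) * Rpower (1 + t) (- s - 1))).
    apply (continuous_mult (fun t => Rpower t (s - 1)) (fun t => Rpower (1 + t) (- s - 1))).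
    + now apply continuous_Rpower.
    + apply (continuous_comp (fun t => 1 + t) (fun t => Rpower t (- s - 1))).
      * apply (ex_derive_continuous (fun t => 1 + t)). auto_derive. auto.
      * apply continuous_Rpower. lra.
  - unfold half_line. intros t Ht.
    assert (H1 := Rpower_pos t s). assert (H2 := Rpower_pos (1 + t) s).
    assert (HKs : 0 < K / s) by (apply Rdiv_lt_0_compat; lra).
    assert (H3 : Rpower t s <= Rpower (1 + t) s) by (apply Rle_Rpower_l; lra).
    rewrite Rpower_Ropp.
    assert (H4 : 0 <= Rpower t s * / Rpower (1 + t) s <= 1).
    { split.
      - apply Rmult_le_pos; [lra|]. apply Rlt_le, Rinv_0_lt_compat; lra.
      - apply (proj2 (Rle_div_l _ _ _ H2)). lra. }
    rewrite Rabs_pos_eq by (apply Rmult_le_pos; lra).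
    rewrite <- (Rmult_1_r (K / s)) at 2. apply Rmult_le_compat_l; lra.
  - unfold GammaPos. change (fun t => Rpower t (s - 1) * exp (- t)) with (gamma_int s).
    now rewrite (is_RInt_gen_unique _ _ HL).
Qed.

Lemma GammaPos_pos (s : R) : 0 < s -> 0 < GammaPos s.
Proof.
  intros Hs. apply (improper_pos half_line _ _ exhausts_half_line (gamma_int s)).
  - intros; now apply continuous_gamma_int.
  - intros; apply gamma_int_pos.
  - now apply is_RInt_gen_gamma.
Qed.

Lemma GammaPos_1 : GammaPos 1 = 1.
Proof.
  assert (H := is_RInt_gen_gamma 1 ltac:(lra)).
  apply (improper_unique half_line _ _ exhausts_half_line _ _ _ H).
  apply (improper_ext half_line _ _ exhausts_half_line (fun t => exp (- t))).
  { intros t Ht. unfold gamma_int. rewrite Rminus_diag, Rpower_O by exact Ht. ring. }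
  match goal with |- is_RInt_gen _ _ _ ?l =>
    replace l with (0 - - exp (- 0)) by (rewrite Ropp_0, exp_0; ring) end.
  apply (improper_FTC half_line _ _ exhausts_half_line (fun t => - exp (- t))).
  - intros t _. auto_derive; auto. ring.
  - intros t _. apply (ex_derive_continuous (fun t => exp (- t))). auto_derive. auto.
  - assert (Hc : continuous (fun t => - exp (- t)) 0).
    { apply (ex_derive_continuous (fun t => - exp (- t))). auto_derive. auto. }
    intros P HP. destruct (Hc P HP) as [eps H']. exists eps. intros y Hy _. now apply H'.
  - apply filterlim_0_infty with 1. intros t Ht.
    rewrite Rabs_Ropp, Rabs_pos_eq by apply Rlt_le, exp_pos.
    rewrite exp_Ropp. unfold Rdiv. rewrite Rmult_1_l.
    apply Rinv_le_contravar; auto. generalize (exp_ineq1_le t). lra.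
Qed.

(** Integration by parts: the difference of the two integrands is the derivative of -t^s exp(-t),
    which tends to 0 at both ends. *)
Lemma GammaPos_succ (s : R) : 0 < s -> GammaPos (s + 1) = s * GammaPos s.
Proof.
  intros Hs.
  assert (H1 := is_RInt_gen_gamma s Hs). assert (H2 := is_RInt_gen_gamma (s + 1) ltac:(lra)).
  assert (H3 := is_RInt_gen_minus _ _ _ _ H2 (is_RInt_gen_scal _ s _ H1)).
  assert (Hz : is_RInt_gen (fun t => minus (gamma_int (s + 1) t) (scal s (gamma_int s t)))
     (at_right 0) (Rbar_locally p_infty) (0 - 0)).
  { destruct (Rpower_exp_bound (s + 1) ltac:(lra)) as (K & HK & HKt).
    apply (improper_FTC half_line _ _ exhausts_half_line (fun t => - (Rpower t s * exp (- t)))).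
    - unfold half_line. intros t Ht.
      assert (D2 : is_derive (fun t => exp (- t)) t (- exp (- t))) by (auto_derive; auto; ring).
      assert (D := is_derive_mult _ _ _ _ _ (is_derive_Rpower t s Ht) D2 Rmult_comm).
      apply is_derive_opp in D.
      match type of D with is_derive _ _ ?d =>
        replace (minus (gamma_int (s + 1) t) (scal s (gamma_int s t))) with d end; [exact D|].
      unfold gamma_int, minus, plus, opp, scal, mult; simpl. unfold mult; simpl.
      replace (s + 1 - 1) with s by ring. ring.
    - intros t Ht. apply (continuous_minus (gamma_int (s + 1)) (fun t => scal s (gamma_int s t))).
      + now apply continuous_gamma_int.
      + apply (continuous_scal_r s (gamma_int s)). now apply continuous_gamma_int.
    - apply filterlim_0_right with s; auto. intros t Ht.
      rewrite Rabs_Ropp, Rabs_pos_eq by (apply Rmult_le_pos; apply Rlt_le, exp_pos).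
      rewrite <- (Rmult_1_r (Rpower t s)) at 2.
      apply Rmult_le_compat_l; [apply Rlt_le, Rpower_pos|].
      rewrite <- exp_0. left. apply exp_increasing. lra.
    - apply filterlim_0_infty with K. intros t Ht.
      rewrite Rabs_Ropp, Rabs_pos_eq by (apply Rmult_le_pos; apply Rlt_le, exp_pos).
      apply (proj1 (Rle_div_r _ _ _ Ht)).
      apply Rle_trans with (2 := HKt t Ht).
      rewrite Rpower_succ by lra.
      assert (H4 : Rpower t s <= Rpower (1 + t) s) by (apply Rle_Rpower_l; lra).
      assert (H5 := Rpower_pos t s). assert (H6 := exp_pos (- t)).
      replace (Rpower t s * exp (- t) * t) with (Rpower t s * t * exp (- t)) by ring.
      apply Rmult_le_compat_r; [lra|]. apply Rmult_le_compat; lra. }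
  apply (improper_unique half_line _ _ exhausts_half_line _ _ _ Hz) in H3.
  unfold minus, plus, opp, scal in H3; simpl in H3. unfold mult in H3; simpl in H3. lra.
Qed.

(** * Wendel's inequality and the asymptotics of Gamma quotients *)

Lemma Rpower_concave (v s : R) : 0 < v -> 0 <= s <= 1 -> Rpower v s <= 1 - s + s * v.
Proof.
  intros Hv Hs. set (y := ln v). unfold Rpower. fold y.
  (* Both [v] and 1 are written as exp(s y) times another exponential. Applying exp u >= 1 + u to
     these with weights [s] and [1 - s] makes the terms linear in [y] cancel. *)
  assert (E1 : v = exp (s * y) * exp ((1 - s) * y)).
  { rewrite <- exp_plus. replace (s * y + (1 - s) * y) with y by ring. unfold y. now rewrite exp_ln. }
  assert (E2 : 1 = exp (s * y) * exp (- (s * y))).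
  { rewrite <- exp_plus. replace (s * y + - (s * y)) with 0 by ring. now rewrite exp_0. }
  assert (P := exp_pos (s * y)).
  assert (I1 := exp_ineq1_le ((1 - s) * y)). assert (I2 := exp_ineq1_le (- (s * y))).
  assert (J1 : exp (s * y) * (s * (1 + (1 - s) * y)) <= exp (s * y) * (s * exp ((1 - s) * y)))
    by (apply Rmult_le_compat_l; [lra|]; apply Rmult_le_compat_l; lra).
  assert (J2 : exp (s * y) * ((1 - s) * (1 + - (s * y))) <= exp (s * y) * ((1 - s) * exp (- (s * y))))
    by (apply Rmult_le_compat_l; [lra|]; apply Rmult_le_compat_l; lra).
  rewrite E1. replace (1 - s) with ((1 - s) * (exp (s * y) * exp (- (s * y)))) at 1 by (rewrite <- E2; ring).
  lra.
Qed.

(** Integrates the pointwise bound t^s <= x^s (1 - s + s t/x) against t^(x-1) exp(-t); the term in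
    t/x returns [GammaPos (x + 1) / x = GammaPos x]. No Hölder inequality is involved. *)
Lemma GammaPos_wendel (x s : R) : 0 < x -> 0 <= s <= 1 ->
  GammaPos (x + s) <= Rpower x s * GammaPos x.
Proof.
  intros Hx Hs.
  assert (E : Rpower x s * GammaPos x
    = plus (scal (Rpower x s * (1 - s)) (GammaPos x)) (scal (Rpower x s * s / x) (GammaPos (x + 1)))).
  { rewrite GammaPos_succ by auto. unfold plus, scal; simpl. unfold mult; simpl. field. lra. }
  rewrite E.
  apply (improper_le half_line _ _ exhausts_half_line (gamma_int (x + s))
    (fun t => plus (scal (Rpower x s * (1 - s)) (gamma_int x t)) (scal (Rpower x s * s / x) (gamma_int (x + 1) t)))).
  - unfold half_line. intros t Ht. unfold plus, scal; simpl. unfold mult; simpl. unfold gamma_int.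
    replace (x + s - 1) with (x - 1 + s) by ring. replace (x + 1 - 1) with (x - 1 + 1) by ring.
    rewrite (Rpower_plus (x - 1) s), (Rpower_plus (x - 1) 1), Rpower_1 by auto.
    assert (Htx : 0 < t / x) by (apply Rdiv_lt_0_compat; lra).
    replace (Rpower t s) with (Rpower (x * (t / x)) s) by (f_equal; field; lra).
    rewrite <- Rpower_mult_distr by lra.
    assert (H := Rpower_concave (t / x) s Htx Hs).
    assert (H1 := Rpower_pos x s). assert (H2 := Rpower_pos t (x - 1)). assert (H3 := exp_pos (- t)).
    apply Rle_trans with (Rpower t (x - 1) * exp (- t) * Rpower x s * (1 - s + s * (t / x))).
    + replace (Rpower t (x - 1) * (Rpower x s * Rpower (t / x) s) * exp (- t))
        with (Rpower t (x - 1) * exp (- t) * Rpower x s * Rpower (t / x) s) by ring.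
      apply Rmult_le_compat_l; [|exact H].
      apply Rmult_le_pos; [apply Rmult_le_pos|]; lra.
    + right. field. lra.
  - apply is_RInt_gen_gamma; lra.
  - apply (is_RInt_gen_plus (fun t => scal (Rpower x s * (1 - s)) (gamma_int x t))
      (fun t => scal (Rpower x s * s / x) (gamma_int (x + 1) t))).
    + apply (is_RInt_gen_scal (gamma_int x)). now apply is_RInt_gen_gamma.
    + apply (is_RInt_gen_scal (gamma_int (x + 1))). apply is_RInt_gen_gamma; lra.
Qed.

Lemma is_lim_seq_INR_ratio (x y : R) :
  is_lim_seq (fun k => (INR k + x) / (INR k + y)) 1.
Proof.
  apply is_lim_seq_ext_loc with (fun k => 1 + (x - y) * / (INR k + y)).
  - eapply filter_imp; [|exact (eventually_INR_gt (- y))].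
    intros k Hk. field. simpl in Hk. lra.
  - replace (Finite 1) with (Finite (1 + (x - y) * 0)) by (f_equal; ring).
    apply (is_lim_seq_plus' (fun _ => 1)); [apply is_lim_seq_const|].
    apply (is_lim_seq_mult' (fun _ => x - y)); [apply is_lim_seq_const|].
    apply (is_lim_seq_inv _ p_infty); [|discriminate].
    apply (is_lim_seq_plus _ _ p_infty y); [apply is_lim_seq_INR|apply is_lim_seq_const|reflexivity].
Qed.

(** Its limit 1 is the weak form of Stirling's formula: Gamma(k + x) is asymptotic to k^x
    Gamma(k). *)
Definition gamma_stirling (x : R) (k : nat) : R :=
  GammaPos (INR k + x) / (GammaPos (INR k) * Rpower (INR k) x).

(** Wendel's inequality from [m] by the step [x] bounds the quotient above; from [m + x] by the step
    [1 - x] it reaches [m + 1], which bounds it below by m/(m+x). *)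
Lemma gamma_stirling_unit (x : R) : 0 <= x <= 1 -> is_lim_seq (gamma_stirling x) 1.
Proof.
  intros Hx.
  apply (is_lim_seq_le_le_loc (fun k => (INR k + 0) / (INR k + x)) _ (fun _ => 1));
    [|apply is_lim_seq_INR_ratio|apply is_lim_seq_const].
  eapply filter_imp; [|exact (eventually_INR_gt 0)]. simpl. intros k Hk.
  set (m := INR k) in *. unfold gamma_stirling. fold m.
  assert (G := GammaPos_pos m Hk). assert (Rp := Rpower_pos m x).
  assert (HD : 0 < GammaPos m * Rpower m x) by now apply Rmult_lt_0_compat.
  split.
  - apply (proj1 (Rle_div_r _ _ _ HD)).
    assert (W := GammaPos_wendel (m + x) (1 - x) ltac:(lra) ltac:(lra)).
    replace (m + x + (1 - x)) with (m + 1) in W by ring. rewrite GammaPos_succ in W by auto.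
    assert (E1 : Rpower (m + x) (1 - x) * Rpower (m + x) x = m + x).
    { rewrite <- Rpower_plus. replace (1 - x + x) with 1 by ring. apply Rpower_1. lra. }
    assert (H1 : Rpower m x <= Rpower (m + x) x) by (apply Rle_Rpower_l; lra).
    assert (H2 := Rpower_pos (m + x) x).
    apply Rmult_le_reg_l with (m + x); [lra|].
    replace ((m + x) * ((m + 0) / (m + x) * (GammaPos m * Rpower m x))) with (m * GammaPos m * Rpower m x)
      by (field; lra).
    apply Rle_trans with (m * GammaPos m * Rpower (m + x) x).
    + apply Rmult_le_compat_l; auto. apply Rmult_le_pos; lra.
    + apply Rle_trans with (Rpower (m + x) (1 - x) * GammaPos (m + x) * Rpower (m + x) x).
      * apply Rmult_le_compat_r; lra.
      * right. transitivity (Rpower (m + x) (1 - x) * Rpower (m + x) x * GammaPos (m + x)); [ring|].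
        now rewrite E1.
  - apply (proj2 (Rle_div_l _ _ _ HD)).
    assert (W := GammaPos_wendel m x Hk Hx). lra.
Qed.

Lemma gamma_stirling_succ (x : R) (k : nat) : 0 < INR k -> 0 < INR k + x ->
  gamma_stirling (x + 1) k = (INR k + x) / (INR k + 0) * gamma_stirling x k.
Proof.
  intros Hk Hkx. unfold gamma_stirling.
  rewrite Rpower_succ, <- Rplus_assoc, GammaPos_succ by auto.
  assert (H1 := GammaPos_pos _ Hk). assert (H2 := Rpower_pos (INR k) x).
  field. repeat split; lra.
Qed.

(** The functional equation changes the quotient by (k+x)/k when [x] moves by 1, a factor tending to
    1; so the unit interval propagates in both directions. *)
Lemma gamma_stirling_lim (x : R) : is_lim_seq (gamma_stirling x) 1.
Proof.
  assert (Hup : forall x, is_lim_seq (gamma_stirling x) 1 -> is_lim_seq (gamma_stirling (x + 1)) 1).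
  { clear x. intros x H.
    apply is_lim_seq_ext_loc with (fun k => (INR k + x) / (INR k + 0) * gamma_stirling x k).
    - eapply filter_imp; [|exact (filter_and _ _ (eventually_INR_gt 0) (eventually_INR_gt (- x)))].
      intros k [H1 H2]. symmetry. apply gamma_stirling_succ; lra.
    - replace (Finite 1) with (Finite (1 * 1)) by (f_equal; ring).
      apply is_lim_seq_mult'; [apply is_lim_seq_INR_ratio|exact H]. }
  assert (Hdown : forall x, is_lim_seq (gamma_stirling (x + 1)) 1 -> is_lim_seq (gamma_stirling x) 1).
  { clear x. intros x H.
    apply is_lim_seq_ext_loc with (fun k => (INR k + 0) / (INR k + x) * gamma_stirling (x + 1) k).
    - eapply filter_imp; [|exact (filter_and _ _ (eventually_INR_gt 0) (eventually_INR_gt (- x)))].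
      intros k [H1 H2]. rewrite gamma_stirling_succ by lra. field. lra.
    - replace (Finite 1) with (Finite (1 * 1)) by (f_equal; ring).
      apply is_lim_seq_mult'; [apply is_lim_seq_INR_ratio|exact H]. }
  assert (H : forall n x, - INR n <= x <= INR n + 1 -> is_lim_seq (gamma_stirling x) 1).
  { clear x. induction n as [|n IH]; intros x Hx.
    - apply gamma_stirling_unit. simpl in Hx. lra.
    - rewrite S_INR in Hx. assert (Hn := pos_INR n).
      destruct (Rlt_le_dec (INR n + 1) x).
      + replace x with (x - 1 + 1) by ring. apply Hup, IH. lra.
      + destruct (Rlt_le_dec x (- INR n)).
        * apply Hdown, IH. lra.
        * apply IH. lra. }
  destruct (eventually_INR_gt (Rabs x)) as [n Hn]. specialize (Hn n (Nat.le_refl n)).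
  apply (H n). apply Rabs_def2 in Hn. lra.
Qed.

(** Equal sums of the shifts make the powers k^p k^q and k^r k^s cancel. *)
Lemma gamma_quotient_lim (p q r s : R) : p + q = r + s ->
  is_lim_seq (fun k => GammaPos (INR k + p) * GammaPos (INR k + q)
                       / (GammaPos (INR k + r) * GammaPos (INR k + s))) 1.
Proof.
  intros E.
  apply is_lim_seq_ext_loc with
    (fun k => gamma_stirling p k * gamma_stirling q k / (gamma_stirling r k * gamma_stirling s k)).
  - eapply filter_imp; [|exact (filter_and _ _ (eventually_INR_gt 0)
      (filter_and _ _ (eventually_INR_gt (- r)) (eventually_INR_gt (- s))))].
    intros k (H0 & H1 & H2). unfold gamma_stirling.
    assert (G0 := GammaPos_pos _ H0).
    assert (G1 := GammaPos_pos (INR k + r) ltac:(lra)).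
    assert (G2 := GammaPos_pos (INR k + s) ltac:(lra)).
    assert (Ep : Rpower (INR k) p * Rpower (INR k) q = Rpower (INR k) r * Rpower (INR k) s)
      by now rewrite <- !Rpower_plus, E.
    assert (P1 := Rpower_pos (INR k) p). assert (P2 := Rpower_pos (INR k) q).
    assert (P3 := Rpower_pos (INR k) r). assert (P4 := Rpower_pos (INR k) s).
    replace (Rpower (INR k) q) with (Rpower (INR k) r * Rpower (INR k) s / Rpower (INR k) p)
      by (rewrite <- Ep; field; lra).
    field. repeat split; lra.
  - replace (Finite 1) with (Finite (1 * 1 / (1 * 1))) by (f_equal; field).
    apply is_lim_seq_div'; [| |lra]; apply is_lim_seq_mult'; apply gamma_stirling_lim.
Qed.

(** * Gamma on the whole real line *)

Lemma poch_add (x : R) (m i : nat) : poch x (m + i) = poch x m * poch (x + INR m) i.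
Proof.
  induction i as [|i IH].
  - rewrite Nat.add_0_r. simpl. ring.
  - rewrite Nat.add_succ_r. simpl. rewrite IH, plus_INR. ring.
Qed.

Lemma GammaPos_add (y : R) (i : nat) : 0 < y -> GammaPos (y + INR i) = poch y i * GammaPos y.
Proof.
  intros Hy. induction i as [|i IH].
  - simpl. rewrite Rplus_0_r. ring.
  - rewrite S_INR, <- Rplus_assoc, GammaPos_succ, IH by (generalize (pos_INR i); lra).
    simpl. ring.
Qed.

Lemma poch_neq_0 (x : R) (k : nat) : ~ nonpos_int x -> poch x k <> 0.
Proof.
  intros Hx. induction k as [|k IH]; simpl; [lra|].
  apply Rmult_integral_contrapositive_currified; auto.
  intros H. apply Hx. exists k. lra.
Qed.

Lemma nonpos_int_pos (x : R) : 0 < x -> ~ nonpos_int x.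
Proof. intros Hx [m Hm]. generalize (pos_INR m). lra. Qed.

Lemma up_to_nat_gt (x : R) : x < INR (Z.to_nat (up x)).
Proof.
  destruct (archimed x) as [H _].
  eapply Rlt_le_trans; [exact H|]. rewrite INR_IZR_INZ. apply IZR_le. lia.
Qed.

(** Frees [Gamma] from the particular shift [N] in its definition: any [k] that makes the argument
    positive gives the same value. *)
Lemma GammaPos_shift (x : R) (k : nat) : ~ nonpos_int x -> 0 < x + INR k ->
  GammaPos (x + INR k) = poch x k * Gamma x.
Proof.
  intros Hx Hk. unfold Gamma. cbv zeta. set (N := Z.to_nat (up (- x))).
  assert (HN : 0 < x + INR N) by (generalize (up_to_nat_gt (- x)); fold N; lra).
  assert (P := poch_neq_0 x N Hx).
  destruct (Nat.le_ge_cases N k) as [Hle|Hle].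
  - replace k with (N + (k - N))%nat by lia. rewrite plus_INR, <- Rplus_assoc, GammaPos_add by auto.
    rewrite poch_add. field. auto.
  - replace (GammaPos (x + INR N)) with (poch (x + INR k) (N - k) * GammaPos (x + INR k)).
    + assert (EP : poch x N = poch x k * poch (x + INR k) (N - k)) by (rewrite <- poch_add; f_equal; lia).
      rewrite EP in P |- *. field. split; intro H; apply P; rewrite H; ring.
    + rewrite <- GammaPos_add by auto. f_equal. rewrite Rplus_assoc, <- plus_INR. do 2 f_equal. lia.
Qed.

Lemma Gamma_pos_eq (x : R) : 0 < x -> Gamma x = GammaPos x.
Proof.
  intros Hx. assert (H := GammaPos_shift x 0 (nonpos_int_pos x Hx)).
  simpl in H. rewrite Rplus_0_r in H. rewrite H by auto. ring.
Qed.

Lemma Gamma_neq_0 (x : R) : ~ nonpos_int x -> Gamma x <> 0.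
Proof.
  intros Hx H. set (k := Z.to_nat (up (- x))).
  assert (Hk : 0 < x + INR k) by (generalize (up_to_nat_gt (- x)); fold k; lra).
  assert (G := GammaPos_shift x k Hx Hk). rewrite H in G.
  generalize (GammaPos_pos _ Hk). lra.
Qed.

Lemma Gamma_add (x : R) (k : nat) : ~ nonpos_int x -> Gamma (x + INR k) = poch x k * Gamma x.
Proof.
  intros Hx.
  assert (Hxk : ~ nonpos_int (x + INR k)).
  { intros [m Hm]. apply Hx. exists (k + m)%nat. rewrite plus_INR. lra. }
  set (n := Z.to_nat (up (- (x + INR k)))).
  assert (Hn : 0 < x + INR k + INR n) by (generalize (up_to_nat_gt (- (x + INR k))); fold n; lra).
  assert (E1 := GammaPos_shift (x + INR k) n Hxk Hn).
  assert (E2 := GammaPos_shift x (k + n) Hx). rewrite plus_INR, <- Rplus_assoc in E2.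
  rewrite E1, poch_add in E2 by auto. specialize (E2 Hn).
  apply Rmult_eq_reg_l with (poch (x + INR k) n); [|now apply poch_neq_0].
  rewrite E2. ring.
Qed.

Lemma Gamma_pole (x : R) : nonpos_int x -> Gamma x = 0.
Proof.
  intros [m Hm]. unfold Gamma. cbv zeta.
  assert (HN := up_to_nat_gt (- x)). set (N := Z.to_nat (up (- x))) in *.
  assert (H : (m < N)%nat) by (apply INR_lt; lra).
  replace (poch x N) with 0; [unfold Rdiv; rewrite Rinv_0; ring|].
  replace N with (S m + (N - S m))%nat by lia. rewrite poch_add. simpl. rewrite Hm. ring.
Qed.

(** * Euler's Beta integral and its recurrences *)

Definition beta_int (a d x : R) : R := Rpower x (a - 1) * Rpower (1 - x) (d - 1).

Lemma beta_int_pos (a d x : R) : 0 < beta_int a d x.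
Proof. apply Rmult_lt_0_compat; apply Rpower_pos. Qed.

Lemma continuous_beta_int (a d x : R) : unit_interval x -> continuous (beta_int a d) x.
Proof.
  intros Hx. apply (continuous_mult (fun x => Rpower x (a - 1)) (fun x => Rpower (1 - x) (d - 1))).
  - apply continuous_Rpower, Hx.
  - apply continuous_Rpower_1m, Hx.
Qed.

Definition Beta (a d : R) : R := RInt_gen (beta_int a d) (at_right 0) (at_left 1).

(** On each side of 1/2 the factor that is singular at the far end is bounded, by [K] or [K']; the
    sum of the two resulting majorants has a bounded explicit antiderivative. *)
Lemma is_RInt_gen_beta (a d : R) : 0 < a -> 0 < d ->
  is_RInt_gen (beta_int a d) (at_right 0) (at_left 1) (Beta a d).
Proof.
  intros Ha Hd.
  set (K := Rpower (1 / 2) (- Rabs (d - 1))). set (K' := Rpower (1 / 2) (- Rabs (a - 1))).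
  assert (HK : 0 < K) by apply Rpower_pos. assert (HK' : 0 < K') by apply Rpower_pos.
  destruct (improper_exists_dominated unit_interval _ _ exhausts_unit (beta_int a d)
    (fun x => K * Rpower x (a - 1) + K' * Rpower (1 - x) (d - 1))
    (fun x => K / a * Rpower x a + - (K' / d) * Rpower (1 - x) d) (K / a + K' / d)) as [L HL].
  - intros; now apply continuous_beta_int.
  - intros x Hx. split; [apply Rlt_le, beta_int_pos|]. unfold unit_interval in Hx.
    assert (P1 := Rpower_pos x (a - 1)). assert (P2 := Rpower_pos (1 - x) (d - 1)). unfold beta_int.
    assert (P3 : 0 <= K * Rpower x (a - 1)) by (apply Rmult_le_pos; lra).
    assert (P4 : 0 <= K' * Rpower (1 - x) (d - 1)) by (apply Rmult_le_pos; lra).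
    destruct (Rle_lt_dec x (1 / 2)).
    + assert (H := Rpower_le_abs (1 / 2) (1 - x) (d - 1) ltac:(lra) ltac:(lra)). fold K in H.
      assert (Rpower x (a - 1) * Rpower (1 - x) (d - 1) <= Rpower x (a - 1) * K)
        by (apply Rmult_le_compat_l; lra). lra.
    + assert (H := Rpower_le_abs (1 / 2) x (a - 1) ltac:(lra) ltac:(lra)). fold K' in H.
      assert (Rpower x (a - 1) * Rpower (1 - x) (d - 1) <= K' * Rpower (1 - x) (d - 1))
        by (apply Rmult_le_compat_r; lra). lra.
  - unfold unit_interval. intros x Hx.
    assert (D1 := is_derive_scal _ x (K / a) _ (is_derive_Rpower x a (proj1 Hx))).
    assert (D2 := is_derive_scal _ x (- (K' / d)) _ (is_derive_Rpower_1m x d (proj2 Hx))).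
    assert (D := is_derive_plus _ _ _ _ _ D1 D2).
    match type of D with is_derive _ _ ?e =>
      replace (K * Rpower x (a - 1) + K' * Rpower (1 - x) (d - 1)) with e end; [exact D|].
    unfold plus; simpl. field. lra.
  - intros x Hx.
    apply (continuous_plus (fun x => K * Rpower x (a - 1)) (fun x => K' * Rpower (1 - x) (d - 1))).
    + apply (continuous_scal_r K (fun x => Rpower x (a - 1))), continuous_Rpower, Hx.
    + apply (continuous_scal_r K' (fun x => Rpower (1 - x) (d - 1))), continuous_Rpower_1m, Hx.
  - unfold unit_interval. intros x Hx.
    assert (Q1 : 0 < K / a) by (apply Rdiv_lt_0_compat; lra).
    assert (Q2 : 0 < K' / d) by (apply Rdiv_lt_0_compat; lra).
    assert (H1 := Rpower_le_1 x a ltac:(lra) ltac:(lra)).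
    assert (H2 := Rpower_le_1 (1 - x) d ltac:(lra) ltac:(lra)).
    assert (H3 := Rpower_pos x a). assert (H4 := Rpower_pos (1 - x) d).
    assert (0 <= K / a * Rpower x a <= K / a * 1)
      by (split; [apply Rmult_le_pos|apply Rmult_le_compat_l]; lra).
    assert (0 <= K' / d * Rpower (1 - x) d <= K' / d * 1)
      by (split; [apply Rmult_le_pos|apply Rmult_le_compat_l]; lra).
    apply Rabs_le. lra.
  - unfold Beta. now rewrite (is_RInt_gen_unique _ _ HL).
Qed.

Lemma Beta_pos (a d : R) : 0 < a -> 0 < d -> 0 < Beta a d.
Proof.
  intros Ha Hd. apply (improper_pos unit_interval _ _ exhausts_unit (beta_int a d)).
  - intros; now apply continuous_beta_int.
  - intros; apply beta_int_pos.
  - now apply is_RInt_gen_beta.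
Qed.

(** The integrated form of x + (1 - x) = 1. *)
Lemma Beta_split (a d : R) : 0 < a -> 0 < d -> Beta (a + 1) d + Beta a (d + 1) = Beta a d.
Proof.
  intros Ha Hd. apply (improper_unique unit_interval _ _ exhausts_unit (beta_int a d));
    [|now apply is_RInt_gen_beta].
  apply (improper_ext unit_interval _ _ exhausts_unit
    (fun x => plus (beta_int (a + 1) d x) (beta_int a (d + 1) x))).
  - unfold unit_interval. intros x Hx. unfold beta_int, plus; simpl.
    replace (a + 1 - 1) with (a - 1 + 1) by ring. replace (d + 1 - 1) with (d - 1 + 1) by ring.
    rewrite !Rpower_succ by lra. ring.
  - apply (is_RInt_gen_plus (beta_int (a + 1) d)); apply is_RInt_gen_beta; lra.
Qed.

(** The difference of the two integrands is the derivative of x^a (1-x)^d, which vanishes at both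
    ends. *)
Lemma Beta_succ_r (a d : R) : 0 < a -> 0 < d -> (a + d) * Beta a (d + 1) = d * Beta a d.
Proof.
  intros Ha Hd. apply Rminus_diag_uniq.
  apply (improper_unique unit_interval _ _ exhausts_unit
    (fun x => minus (scal (a + d) (beta_int a (d + 1) x)) (scal d (beta_int a d x)))).
  - apply (is_RInt_gen_minus (fun x => scal (a + d) (beta_int a (d + 1) x)) (fun x => scal d (beta_int a d x))).
    + apply (is_RInt_gen_scal (beta_int a (d + 1))), is_RInt_gen_beta; lra.
    + apply (is_RInt_gen_scal (beta_int a d)), is_RInt_gen_beta; lra.
  - replace 0 with (0 - 0) at 2 by ring.
    assert (Hb : forall x, 0 < x < 1 -> 0 < Rpower x a <= 1 /\ 0 < Rpower (1 - x) d <= 1).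
    { intros x Hx. repeat split; try apply Rpower_pos; apply Rpower_le_1; lra. }
    apply (improper_FTC unit_interval _ _ exhausts_unit (fun x => Rpower x a * Rpower (1 - x) d)).
    + unfold unit_interval. intros x Hx.
      assert (D := is_derive_mult _ _ _ _ _ (is_derive_Rpower x a (proj1 Hx))
        (is_derive_Rpower_1m x d (proj2 Hx)) Rmult_comm).
      match type of D with is_derive _ _ ?e =>
        replace (minus (scal (a + d) (beta_int a (d + 1) x)) (scal d (beta_int a d x))) with e end; [exact D|].
      unfold beta_int, minus, plus, opp, scal; simpl. unfold mult; simpl.
      replace (d + 1 - 1) with d by ring.
      replace (Rpower x a) with (Rpower x (a - 1) * x) by (rewrite <- Rpower_succ by lra; f_equal; ring).
      replace (Rpower (1 - x) d) with (Rpower (1 - x) (d - 1) * (1 - x))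
        by (rewrite <- Rpower_succ by lra; f_equal; ring).
      ring.
    + intros x Hx.
      apply (continuous_minus (fun x => scal (a + d) (beta_int a (d + 1) x)) (fun x => scal d (beta_int a d x))).
      * apply (continuous_scal_r (a + d) (beta_int a (d + 1))). now apply continuous_beta_int.
      * apply (continuous_scal_r d (beta_int a d)). now apply continuous_beta_int.
    + apply filterlim_0_right with a; auto. intros x Hx. destruct (Hb x Hx).
      rewrite Rabs_pos_eq by (apply Rmult_le_pos; lra).
      rewrite <- (Rmult_1_r (Rpower x a)) at 2. apply Rmult_le_compat_l; lra.
    + apply filterlim_0_left with d; auto. intros x Hx. destruct (Hb x Hx).
      rewrite Rabs_pos_eq by (apply Rmult_le_pos; lra).
      rewrite <- (Rmult_1_l (Rpower (1 - x) d)) at 2. apply Rmult_le_compat_r; lra.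
Qed.

Lemma Beta_succ_l (a d : R) : 0 < a -> 0 < d -> (a + d) * Beta (a + 1) d = a * Beta a d.
Proof.
  intros Ha Hd. assert (H1 := Beta_split a d Ha Hd). assert (H2 := Beta_succ_r a d Ha Hd).
  replace (Beta (a + 1) d) with (Beta a d - Beta a (d + 1)) by lra.
  rewrite Rmult_minus_distr_l, H2. ring.
Qed.

Lemma Beta_1_l (d : R) : 0 < d -> Beta 1 d = / d.
Proof.
  intros Hd. apply (improper_unique unit_interval _ _ exhausts_unit (beta_int 1 d)).
  { apply is_RInt_gen_beta; lra. }
  replace (/ d) with (0 - - / d * Rpower (1 - 0) d)
    by (rewrite Rminus_0_r; unfold Rpower; rewrite ln_1, Rmult_0_r, exp_0; ring).
  assert (HD : forall x, x < 1 -> is_derive (fun x => - / d * Rpower (1 - x) d) x (Rpower (1 - x) (d - 1))).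
  { intros x Hx. assert (D := is_derive_scal _ x (- / d) _ (is_derive_Rpower_1m x d Hx)).
    replace (Rpower (1 - x) (d - 1)) with (- / d * - (d * Rpower (1 - x) (d - 1))) by (field; lra).
    exact D. }
  apply (improper_ext unit_interval _ _ exhausts_unit (fun x => Rpower (1 - x) (d - 1))).
  { intros x Hx. unfold beta_int. rewrite Rminus_diag, Rpower_O by apply Hx. ring. }
  apply (improper_FTC unit_interval _ _ exhausts_unit (fun x => - / d * Rpower (1 - x) d)).
  - intros x Hx. apply HD, Hx.
  - intros x Hx. apply continuous_Rpower_1m, Hx.
  - assert (Hc : continuous (fun x => - / d * Rpower (1 - x) d) 0).
    { apply (ex_derive_continuous (fun x => - / d * Rpower (1 - x) d)).
      exists (Rpower (1 - 0) (d - 1)). apply HD. lra. }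
    intros P HP. destruct (Hc P HP) as [eps H']. exists eps. intros y Hy _. now apply H'.
  - rewrite <- (Rmult_0_r (- / d)).
    apply (filterlim_comp _ _ _ (fun x => Rpower (1 - x) d) (fun y => - / d * y) _ (locally 0)).
    + apply filterlim_0_left with d; auto. intros x Hx. rewrite Rabs_pos_eq; [lra|apply Rlt_le, Rpower_pos].
    + apply (ex_derive_continuous (fun y => - / d * y) 0). auto_derive. auto.
Qed.

Lemma Beta_antitone (a a' d : R) : 0 < a -> a <= a' -> 0 < d -> Beta a' d <= Beta a d.
Proof.
  intros Ha Haa Hd.
  apply (improper_le unit_interval _ _ exhausts_unit (beta_int a' d) (beta_int a d)).
  - unfold unit_interval. intros x Hx. unfold beta_int.
    apply Rmult_le_compat_r; [apply Rlt_le, Rpower_pos|].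
    replace (a' - 1) with (a - 1 + (a' - a)) by ring. rewrite Rpower_plus.
    rewrite <- (Rmult_1_r (Rpower x (a - 1))) at 2.
    apply Rmult_le_compat_l; [apply Rlt_le, Rpower_pos|]. apply Rpower_le_1; lra.
  - apply is_RInt_gen_beta; lra.
  - apply is_RInt_gen_beta; lra.
Qed.

(** * Moments of the weights *)

(** Normalised so that the Beta-Gamma formula says that this does not depend on [a] and equals
    [GammaPos d]. *)
Definition beta_gamma_ratio (d a : R) : R := Beta a d * GammaPos (a + d) / GammaPos a.

Lemma beta_gamma_ratio_succ (d a : R) : 0 < a -> 0 < d ->
  beta_gamma_ratio d (a + 1) = beta_gamma_ratio d a.
Proof.
  intros Ha Hd. unfold beta_gamma_ratio.
  replace (a + 1 + d) with (a + d + 1) by ring.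
  rewrite !GammaPos_succ by lra.
  assert (E := Beta_succ_l a d Ha Hd). assert (G := GammaPos_pos a Ha).
  replace (Beta (a + 1) d * ((a + d) * GammaPos (a + d)))
    with ((a + d) * Beta (a + 1) d * GammaPos (a + d)) by ring.
  rewrite E. field. lra.
Qed.

Lemma beta_gamma_ratio_add (d a : R) (k : nat) : 0 < a -> 0 < d ->
  beta_gamma_ratio d (a + INR k) = beta_gamma_ratio d a.
Proof.
  intros Ha Hd. induction k as [|k IH].
  - simpl. now rewrite Rplus_0_r.
  - rewrite S_INR, <- Rplus_assoc, beta_gamma_ratio_succ; auto. generalize (pos_INR k); lra.
Qed.

(* The ratio is 1-periodic in [a]; monotonicity of Beta and the asymptotics of Gamma identify it
   with its value at the integers. *)
Lemma beta_gamma_ratio_eq (d a : R) : 0 < a -> 0 < d -> beta_gamma_ratio d a = GammaPos d.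
Proof.
  intros Ha Hd.
  assert (H1 : beta_gamma_ratio d 1 = GammaPos d).
  { unfold beta_gamma_ratio. rewrite Beta_1_l, GammaPos_1 by auto.
    rewrite (Rplus_comm 1 d), GammaPos_succ by auto. field. lra. }
  assert (Hunit : forall a, 0 < a <= 1 -> beta_gamma_ratio d a = GammaPos d).
  { clear a Ha. intros a Ha.
    (* By periodicity the ratio at [a] is the ratio at [a + k], which is the ratio at the integer
       [k] times the Beta quotient below times [Q k]; both correction factors tend to 1. *)
    set (Q := fun k => GammaPos (INR k + (a + d)) * GammaPos (INR k + 0)
                       / (GammaPos (INR k + a) * GammaPos (INR k + d))).
    assert (HQ : is_lim_seq Q 1) by exact (gamma_quotient_lim (a + d) 0 a d ltac:(ring)).
    assert (HB : is_lim_seq (fun k => Beta (INR k + a) d / Beta (INR k) d) 1).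
    { apply (is_lim_seq_le_le_loc (fun k => (INR k + 0) / (INR k + d)) _ (fun _ => 1));
        [|apply is_lim_seq_INR_ratio|apply is_lim_seq_const].
      eapply filter_imp; [|exact (eventually_INR_gt 0)]. simpl. intros k Hk.
      assert (B := Beta_pos (INR k) d Hk Hd).
      assert (B1 := Beta_antitone (INR k) (INR k + a) d Hk ltac:(lra) Hd).
      assert (B2 := Beta_antitone (INR k + a) (INR k + 1) d ltac:(lra) ltac:(lra) Hd).
      assert (B3 := Beta_succ_l (INR k) d Hk Hd).
      split.
      - apply (proj1 (Rle_div_r _ _ _ B)).
        replace ((INR k + 0) / (INR k + d) * Beta (INR k) d) with (Beta (INR k + 1) d); [exact B2|].
        apply Rmult_eq_reg_l with (INR k + d); [|lra]. rewrite B3. field. lra.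
      - apply (proj2 (Rle_div_l _ _ _ B)). lra. }
    assert (HL : is_lim_seq (fun k => Beta (INR k + a) d / Beta (INR k) d * GammaPos d * Q k) (1 * GammaPos d * 1)).
    { apply (is_lim_seq_mult' (fun k => Beta (INR k + a) d / Beta (INR k) d * GammaPos d) Q); [|exact HQ].
      apply (is_lim_seq_mult' _ (fun _ => GammaPos d)); [exact HB|apply is_lim_seq_const]. }
    assert (HC : is_lim_seq (fun k => Beta (INR k + a) d / Beta (INR k) d * GammaPos d * Q k) (beta_gamma_ratio d a)).
    { apply is_lim_seq_ext_loc with (fun _ => beta_gamma_ratio d a); [|apply is_lim_seq_const].
      eapply filter_imp; [|exact (eventually_INR_gt 0)]. intros k Hk.
      assert (Ek : beta_gamma_ratio d (INR k) = GammaPos d).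
      { destruct k as [|k]; [simpl in Hk; lra|].
        rewrite S_INR, Rplus_comm, beta_gamma_ratio_add; auto; lra. }
      rewrite <- Ek, <- (beta_gamma_ratio_add d a k) by lra.
      unfold beta_gamma_ratio, Q. rewrite Rplus_0_r.
      replace (a + INR k) with (INR k + a) by ring.
      replace (INR k + a + d) with (INR k + (a + d)) by ring.
      assert (B := Beta_pos (INR k) d Hk Hd).
      assert (G1 := GammaPos_pos (INR k) Hk).
      assert (G2 := GammaPos_pos (INR k + a) ltac:(lra)).
      assert (G3 := GammaPos_pos (INR k + d) ltac:(lra)).
      field. repeat split; lra. }
    apply is_lim_seq_unique in HL. apply is_lim_seq_unique in HC.
    rewrite HL in HC. injection HC. intros E. rewrite <- E. ring. }
  assert (Hn : forall n a, 0 < a <= INR n + 1 -> beta_gamma_ratio d a = GammaPos d).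
  { clear a Ha. induction n as [|n IH]; intros a Ha.
    - apply Hunit. simpl in Ha. lra.
    - rewrite S_INR in Ha. destruct (Rle_lt_dec a 1); [apply Hunit; lra|].
      replace a with (a - 1 + 1) by ring. rewrite beta_gamma_ratio_succ by lra. apply IH. lra. }
  destruct (eventually_INR_gt a) as [n H]. specialize (H n (Nat.le_refl n)).
  apply (Hn n). lra.
Qed.

Lemma Beta_GammaPos (a d : R) : 0 < a -> 0 < d ->
  Beta a d = GammaPos a * GammaPos d / GammaPos (a + d).
Proof.
  intros Ha Hd. assert (E := beta_gamma_ratio_eq d a Ha Hd). unfold beta_gamma_ratio in E.
  assert (G1 := GammaPos_pos a Ha). assert (G2 := GammaPos_pos (a + d) ltac:(lra)).
  rewrite <- E. field. lra.
Qed.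

Lemma Beta_add_r (a d : R) (j : nat) : 0 < a -> 0 < d ->
  Beta a (d + INR j) = Beta a d * poch d j / poch (a + d) j.
Proof.
  intros Ha Hd. induction j as [|j IH].
  - simpl. rewrite Rplus_0_r. field.
  - assert (Hj := pos_INR j). assert (P := poch_pos (a + d) j ltac:(lra)).
    rewrite S_INR, <- Rplus_assoc. apply Rmult_eq_reg_l with (a + (d + INR j)); [|lra].
    rewrite Beta_succ_r, IH by lra. simpl. field. lra.
Qed.

(** The hypothesis controls the terms with lower parameter a + d, not [d]. Passing between them
    costs the factor (a+d)_j / (d)_j, which y^j absorbs by d'Alembert's test. *)
Lemma gauss_term_power_summable (A B a d y : R) : 0 < a -> 0 < d -> 0 < a + d - A - B -> 0 < y < 1 ->
  ex_series (fun j => Rabs (gauss_term A B d j) * y ^ j).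
Proof.
  intros Ha Hd Hs Hy.
  destruct (gauss_summable A B (a + d) ltac:(lra) Hs) as [Hsum _].
  set (T := Series (fun j => Rabs (gauss_term A B (a + d) j))).
  set (r := fun j => poch (a + d) j / poch d j * y ^ j).
  assert (Hr : forall j, 0 < r j).
  { intros j. apply Rmult_lt_0_compat; [|apply pow_lt; lra].
    apply Rdiv_lt_0_compat; apply poch_pos; lra. }
  assert (HT : forall j, Rabs (gauss_term A B (a + d) j) <= T).
  { intros j. apply Rle_trans with (sum_n (fun j => Rabs (gauss_term A B (a + d) j)) j).
    - destruct j as [|j]; [rewrite sum_O; lra|]. rewrite sum_n_Sn_R.
      assert (H := sum_n_ge_0 (fun j => Rabs (gauss_term A B (a + d) j)) j ltac:(intros; apply Rabs_pos)).
      lra.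
    - apply (sum_n_le_Series (fun j => Rabs (gauss_term A B (a + d) j))); auto. intros; apply Rabs_pos. }
  assert (Hser : ex_series (fun j => Rabs (r j))).
  { apply (ex_series_DAlembert r y); [lra|intros j; generalize (Hr j); lra|].
    apply is_lim_seq_ext with (fun j => (INR j + (a + d)) / (INR j + d) * y).
    - intros j. rewrite Rabs_pos_eq by (apply Rlt_le, Rdiv_lt_0_compat; auto).
      unfold r. assert (P1 := poch_pos (a + d) j ltac:(lra)). assert (P2 := poch_pos d j Hd).
      assert (Hj := pos_INR j). assert (Py := pow_lt y j ltac:(lra)).
      simpl. field. repeat split; lra.
    - replace (Finite y) with (Finite (1 * y)) by (f_equal; ring).
      apply (is_lim_seq_mult' _ (fun _ => y)); [apply is_lim_seq_INR_ratio|apply is_lim_seq_const]. }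
  apply (ex_series_le (fun j => Rabs (gauss_term A B d j) * y ^ j) (fun j => T * Rabs (r j)));
    [|now apply (ex_series_scal_l T (fun j => Rabs (r j)))].
  intros j. change (Rabs (Rabs (gauss_term A B d j) * y ^ j) <= T * Rabs (r j)).
  assert (Py := pow_lt y j ltac:(lra)).
  rewrite Rabs_pos_eq by (apply Rmult_le_pos; [apply Rabs_pos|lra]).
  rewrite (Rabs_pos_eq (r j)) by apply Rlt_le, Hr.
  assert (P1 := poch_pos (a + d) j ltac:(lra)). assert (P2 := poch_pos d j Hd).
  assert (E : gauss_term A B d j = gauss_term A B (a + d) j * (poch (a + d) j / poch d j)).
  { unfold gauss_term. assert (F := INR_fact_pos j). field. repeat split; lra. }
  rewrite E, Rabs_mult, (Rabs_pos_eq (_ / _)) by (apply Rlt_le, Rdiv_lt_0_compat; lra).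
  unfold r. rewrite Rmult_assoc. apply Rmult_le_compat_r; [|apply HT].
  apply Rlt_le, Hr.
Qed.

(** Integrating (1-x)^j against the Beta weight multiplies by (d)_j / (a+d)_j, so the lower
    parameter [d] becomes a + d and the series is taken at 1. *)
Lemma hyp2f1_beta_integral (A B a d : R) : 0 < a -> 0 < d -> 0 < a + d - A - B ->
  is_RInt_gen (fun x => hyp2f1 A B d (1 - x) * beta_int a d x) (at_right 0) (at_left 1)
    (Beta a d * Series (gauss_term A B (a + d))).
Proof.
  intros Ha Hd Hs.
  set (h := fun j x => beta_int a (d + INR j) x).
  assert (Hh : forall j x, unit_interval x -> h j x = (1 - x) ^ j * beta_int a d x).
  { unfold unit_interval. intros j x Hx. unfold h, beta_int.
    replace (d + INR j - 1) with (d - 1 + INR j) by ring.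
    rewrite Rpower_plus, Rpower_pow by lra. ring. }
  assert (E : forall j, gauss_term A B d j * Beta a (d + INR j) = Beta a d * gauss_term A B (a + d) j).
  { intros j. rewrite Beta_add_r by auto. unfold gauss_term.
    assert (P1 := poch_pos (a + d) j ltac:(lra)). assert (P2 := poch_pos d j Hd).
    assert (F := INR_fact_pos j). field. repeat split; lra. }
  rewrite <- Series_scal_l.
  rewrite <- (Series_ext _ _ E).
  apply (improper_ext unit_interval _ _ exhausts_unit (fun x => Series (fun j => gauss_term A B d j * h j x))).
  { intros x Hx. unfold hyp2f1. rewrite <- Series_scal_r. apply Series_ext. intros j.
    rewrite Hh by auto. unfold gauss_term. ring. }
  apply (improper_Series unit_interval _ _ exhausts_unit h (gauss_term A B d) (fun j => Beta a (d + INR j))).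
  - intros j x Hx. now apply continuous_beta_int.
  - intros j x Hx. apply Rlt_le, beta_int_pos.
  - intros j. apply is_RInt_gen_beta; auto. generalize (pos_INR j); lra.
  - destruct (gauss_summable A B (a + d) ltac:(lra) Hs) as [Hsum _].
    apply (ex_series_scal_l (Beta a d)) in Hsum.
    eapply ex_series_ext; [|exact Hsum]. intros j.
    change (Beta a d * Rabs (gauss_term A B (a + d) j) = Rabs (gauss_term A B d j) * Beta a (d + INR j)).
    assert (B1 := Beta_pos a d Ha Hd).
    assert (B2 := Beta_pos a (d + INR j) Ha ltac:(generalize (pos_INR j); lra)).
    rewrite <- (Rabs_pos_eq (Beta a d)) by lra.
    rewrite <- (Rabs_pos_eq (Beta a (d + INR j))) by lra.
    now rewrite <- !Rabs_mult, E.
  - unfold unit_interval. intros p q Hp Hq Hpq.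
    (* On [p, q] the weight is at most [M] and 1 - x <= 1 - p < 1, which gives a geometric-type
       majorant. *)
    set (M := Rpower p (- Rabs (a - 1)) * Rpower (1 - q) (- Rabs (d - 1))).
    exists (fun j => M * (Rabs (gauss_term A B d j) * (1 - p) ^ j)). split.
    + apply (ex_series_scal_l M (fun j => Rabs (gauss_term A B d j) * (1 - p) ^ j)).
      apply (gauss_term_power_summable A B a); auto; lra.
    + intros j x Hx. rewrite Hh by (unfold unit_interval; lra).
      assert (P := beta_int_pos a d x). assert (Py := pow_le (1 - x) j ltac:(lra)).
      rewrite Rabs_mult, (Rabs_pos_eq (_ * _)) by (apply Rmult_le_pos; lra).
      assert (H1 : beta_int a d x <= M).
      { apply Rmult_le_compat; try (apply Rlt_le, Rpower_pos).
        - apply Rpower_le_abs; lra.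
        - apply Rpower_le_abs; lra. }
      assert (H2 : (1 - x) ^ j <= (1 - p) ^ j) by (apply pow_incr; lra).
      replace (M * (Rabs (gauss_term A B d j) * (1 - p) ^ j))
        with (Rabs (gauss_term A B d j) * ((1 - p) ^ j * M)) by ring.
      apply Rmult_le_compat_l; [apply Rabs_pos|]. apply Rmult_le_compat; lra.
Qed.

(** With C = a + delta = c + d - b the parameters of Gauss's theorem are C - A = d, C - B = c and C
    - A - B = b. Since c + d = C + b, the Gamma quotient limit identifies the limit of the
    Pochhammer quotients. *)
Lemma gauss_summation (a b c d : R) : 0 < a -> 0 < b -> 0 < delta a b c d ->
  ~ nonpos_int c -> ~ nonpos_int d ->
  Series (gauss_term (c - b) (d - b) (a + delta a b c d))
  = GammaPos (a + delta a b c d) * GammaPos b / (Gamma c * Gamma d).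
Proof.
  intros Ha Hb Hdelta Hc Hd.
  set (C := a + delta a b c d).
  assert (HC : 0 < C) by (unfold C; lra).
  assert (EC : C + b = c + d) by (unfold C, delta; ring).
  assert (L := gauss_summation_limit (c - b) (d - b) C HC ltac:(lra)).
  replace (C - (c - b)) with d in L by lra. replace (C - (d - b)) with c in L by lra.
  replace (C - (c - b) - (d - b)) with b in L by lra.
  replace (d - (d - b)) with b in L by ring.
  assert (G := gamma_quotient_lim d c C b ltac:(lra)).
  assert (GC := GammaPos_pos C HC). assert (Gb := GammaPos_pos b Hb).
  assert (Gc := Gamma_neq_0 c Hc). assert (Gd := Gamma_neq_0 d Hd).
  assert (L' : is_lim_seq (fun k => poch d k * poch c k / (poch C k * poch b k))
     (GammaPos C * GammaPos b / (Gamma c * Gamma d) * 1)).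
  { eapply is_lim_seq_ext_loc; [|exact (is_lim_seq_mult'
      (fun _ => GammaPos C * GammaPos b / (Gamma c * Gamma d)) _ _ _ (is_lim_seq_const _) G)].
    eapply filter_imp; [|exact (filter_and _ _ (eventually_INR_gt (- c)) (eventually_INR_gt (- d)))].
    intros k [H1 H2]. rewrite !(Rplus_comm (INR k)).
    rewrite (GammaPos_shift c), (GammaPos_shift d) by (auto; lra).
    rewrite !GammaPos_add by auto.
    assert (PC := poch_pos C k HC). assert (Pb := poch_pos b k Hb).
    field. repeat split; auto; lra. }
  apply is_lim_seq_unique in L. apply is_lim_seq_unique in L'. rewrite L in L'.
  injection L'. intros ->. ring.
Qed.

Lemma w1_moment (a b c d : R) (k : nat) : 0 < a -> 0 < b -> 0 < delta a b c d ->
  ~ nonpos_int c -> ~ nonpos_int d ->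
  mu_moment a b c d (w1 a b c d) k (poch a k * poch b k / (poch c k * poch d k)).
Proof.
  intros Ha Hb Hdelta Hc Hd. unfold mu_moment.
  set (de := delta a b c d) in *. assert (Hk := pos_INR k).
  (* Adding [k] to all four parameters absorbs the factor [x^k] and changes neither [w1] nor [delta]. *)
  assert (Ede : delta (a + INR k) (b + INR k) (c + INR k) (d + INR k) = de) by (unfold de, delta; ring).
  assert (H := hyp2f1_beta_integral (c - b) (d - b) (a + INR k) de ltac:(lra) Hdelta
    ltac:(unfold de, delta; lra)).
  assert (Hpole : forall x, ~ nonpos_int x -> ~ nonpos_int (x + INR k)).
  { intros x Hx [m Hm]. apply Hx. exists (k + m)%nat. rewrite plus_INR. lra. }
  assert (S := gauss_summation (a + INR k) (b + INR k) (c + INR k) (d + INR k)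
    ltac:(lra) ltac:(lra) ltac:(rewrite Ede; lra) (Hpole c Hc) (Hpole d Hd)).
  rewrite Ede in S.
  replace (c + INR k - (b + INR k)) with (c - b) in S by ring.
  replace (d + INR k - (b + INR k)) with (d - b) in S by ring.
  rewrite S, Beta_GammaPos in H by lra.
  rewrite !GammaPos_add, !Gamma_add in H by auto.
  apply (is_RInt_gen_scal _ (mu_const a b c d)) in H.
  match type of H with is_RInt_gen _ _ _ ?v =>
    replace (poch a k * poch b k / (poch c k * poch d k)) with v end.
  - apply (improper_ext unit_interval _ _ exhausts_unit) with (2 := H).
    unfold unit_interval. intros x Hx. unfold scal; simpl. unfold mult; simpl.
    f_equal. unfold beta_int, w1. fold de.
    replace (a + INR k - 1) with (a - 1 + INR k) by ring.
    rewrite Rpower_plus, Rpower_pow by lra. ring.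
  - unfold scal; simpl. unfold mult; simpl. unfold mu_const. fold de.
    rewrite (Gamma_pos_eq a), (Gamma_pos_eq b), (Gamma_pos_eq de) by auto.
    assert (G1 := GammaPos_pos a Ha). assert (G2 := GammaPos_pos b Hb).
    assert (G3 := GammaPos_pos de Hdelta).
    assert (G4 := GammaPos_pos (a + INR k + de) ltac:(lra)).
    assert (G5 := Gamma_neq_0 c Hc). assert (G6 := Gamma_neq_0 d Hd).
    assert (G7 := poch_neq_0 c k Hc). assert (G8 := poch_neq_0 d k Hd).
    field. repeat split; auto; lra.
Qed.

(** Raising [b] and [c] by 1 keeps [delta], turns [w1] into (b/c) [w2] and multiplies the constant
    of the measure by c/b, so the moment is the [w1] moment for the raised parameters. *)
Lemma w2_moment (a b c d : R) (k : nat) : 0 < a -> 0 < b -> 0 < delta a b c d ->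
  ~ nonpos_int c -> ~ nonpos_int d ->
  mu_moment a b c d (w2 a b c d) k
    (poch a k * poch b k / (poch c k * poch d k) * (c / b) * ((b + INR k) / (c + INR k))).
Proof.
  intros Ha Hb Hdelta Hc Hd. assert (Hk := pos_INR k).
  assert (Hc0 : c <> 0) by (intros ->; apply Hc; exists 0%nat; simpl; ring).
  assert (Hck : c + INR k <> 0) by (intros E; apply Hc; exists k; lra).
  assert (Hc1 : ~ nonpos_int (c + 1)).
  { intros [m Hm]. apply Hc. exists (S m). rewrite S_INR. lra. }
  assert (Ede : delta a (b + 1) (c + 1) d = delta a b c d) by (unfold delta; ring).
  assert (H := w1_moment a (b + 1) (c + 1) d k Ha ltac:(lra) ltac:(lra) Hc1 Hd).
  unfold mu_moment in *.
  assert (Emu : mu_const a (b + 1) (c + 1) d = mu_const a b c d * (c / b)).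
  { unfold mu_const. rewrite Ede.
    assert (Eb := Gamma_add b 1 (nonpos_int_pos b Hb)). assert (Ec := Gamma_add c 1 Hc). simpl in Eb, Ec.
    rewrite Eb, Ec, !(Gamma_pos_eq _ Ha), (Gamma_pos_eq _ Hb), (Gamma_pos_eq _ Hdelta).
    assert (G1 := GammaPos_pos a Ha). assert (G2 := GammaPos_pos b Hb).
    assert (G3 := GammaPos_pos _ Hdelta). field. repeat split; lra. }
  rewrite Emu, Ede in H.
  match type of H with is_RInt_gen _ _ _ ?v =>
    replace (poch a k * poch b k / (poch c k * poch d k) * (c / b) * ((b + INR k) / (c + INR k))) with v end.
  - apply (improper_ext unit_interval _ _ exhausts_unit) with (2 := H).
    intros x _. unfold w1, w2. rewrite Ede.
    replace (c + 1 - (b + 1)) with (c - b) by ring. replace (d - (b + 1)) with (d - b - 1) by ring.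
    ring.
  - assert (Pb := poch_shift b k). assert (Pc := poch_shift c k).
    assert (G7 := poch_neq_0 c k Hc). assert (G8 := poch_neq_0 d k Hd).
    assert (G9 := poch_neq_0 _ k Hc1).
    replace (poch (b + 1) k) with (poch b k * (b + INR k) / b) by (rewrite <- Pb; field; lra).
    replace (poch (c + 1) k) with (poch c k * (c + INR k) / c) by (rewrite <- Pc; field; lra).
    field. repeat split; auto; lra.
Qed.

(** * Divided differences and the reproducing kernel *)

(** Newton's divided difference at the nodes 0, ..., n. The recursive form makes explicit binomial
    sums unnecessary. *)
Fixpoint ddiff (n : nat) (f : nat -> R) : R :=
  match n with
  | O => f 0%nat
  | S m => (ddiff m (fun k => f (S k)) - ddiff m f) / INR (S m)
  end.

Lemma ddiff_ext (n : nat) (f g : nat -> R) :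
  (forall k, (k <= n)%nat -> f k = g k) -> ddiff n f = ddiff n g.
Proof.
  revert f g. induction n as [|n IH]; intros f g H.
  - apply H. lia.
  - cbn [ddiff]. rewrite (IH f g), (IH (fun k => f (S k)) (fun k => g (S k))); auto;
      intros; apply H; lia.
Qed.

Lemma ddiff_plus (n : nat) (f g : nat -> R) :
  ddiff n (fun k => f k + g k) = ddiff n f + ddiff n g.
Proof.
  revert f g. induction n as [|n IH]; intros f g; [reflexivity|].
  cbn [ddiff]. rewrite (IH f g), (IH (fun k => f (S k)) (fun k => g (S k))).
  unfold Rdiv. ring.
Qed.

Lemma ddiff_scal (n : nat) (x : R) (f : nat -> R) :
  ddiff n (fun k => x * f k) = x * ddiff n f.
Proof.
  revert f. induction n as [|n IH]; intros f; [reflexivity|].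
  cbn [ddiff]. rewrite (IH f), (IH (fun k => f (S k))). unfold Rdiv. ring.
Qed.

(** The weight of the last node is 1/n!; this is the case that orthogonality produces. *)
Lemma ddiff_top (n : nat) (f : nat -> R) :
  (forall k, (k < n)%nat -> f k = 0) -> ddiff n f = f n / INR (fact n).
Proof.
  revert f. induction n as [|n IH]; intros f H.
  - simpl. field.
  - cbn [ddiff]. rewrite (IH (fun k => f (S k))) by (intros; apply H; lia).
    rewrite (ddiff_ext n f (fun k => 0 * f k)) by (intros; rewrite H by lia; ring).
    rewrite ddiff_scal. change (fact (S n)) with (S n * fact n)%nat. rewrite mult_INR.
    assert (H1 := INR_fact_pos n). assert (H2 : 0 < INR (S n)) by (apply lt_0_INR; lia).
    field. lra.
Qed.

(** Leibniz rule with a monic linear factor: only its value at the last node and its slope 1 occur.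
    Shifting the nodes replaces [r] by [1 + r], so the induction must leave [r] general. *)
Lemma ddiff_leibniz (n : nat) (r : R) (f : nat -> R) :
  ddiff (S n) (fun k => (INR k + r) * f k) = (INR (S n) + r) * ddiff (S n) f + ddiff n f.
Proof.
  revert r f. induction n as [|n IH]; intros r f.
  - simpl. field.
  - assert (E : forall h, ddiff (S (S n)) h
      = (ddiff (S n) (fun k => h (S k)) - ddiff (S n) h) / INR (S (S n))) by reflexivity.
    rewrite !E.
    rewrite (ddiff_ext (S n) (fun k => (INR (S k) + r) * f (S k)) (fun k => (INR k + (1 + r)) * f (S k)))
      by (intros; rewrite S_INR; ring).
    rewrite (IH (1 + r) (fun k => f (S k))), (IH r f).
    assert (Hn := pos_INR n). assert (H2 : INR (S n) = INR n + 1) by apply S_INR.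
    assert (E1 : ddiff n (fun k => f (S k)) = INR (S n) * ddiff (S n) f + ddiff n f)
      by (cbn [ddiff]; field; lra).
    rewrite E1, (S_INR (S n)), H2. field. lra.
Qed.

(* Holds when [f k] is a monic polynomial of degree [m] in [k]. *)
Definition ddiff_monic (m : nat) (f : nat -> R) : Prop :=
  ddiff m f = 1 /\ forall n, (m < n)%nat -> ddiff n f = 0.

Lemma ddiff_monic_ext (m : nat) (f g : nat -> R) :
  (forall k, f k = g k) -> ddiff_monic m f -> ddiff_monic m g.
Proof.
  intros E [H1 H2]. split.
  - rewrite <- H1. symmetry. apply ddiff_ext. auto.
  - intros n Hn. rewrite <- (H2 n Hn). symmetry. apply ddiff_ext. auto.
Qed.

Lemma ddiff_monic_1 : ddiff_monic 0 (fun _ => 1).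
Proof.
  split; [reflexivity|]. intros [|n] Hn; [lia|]. cbn [ddiff]. unfold Rdiv. ring.
Qed.

Lemma ddiff_monic_linear (m : nat) (r : R) (f : nat -> R) :
  ddiff_monic m f -> ddiff_monic (S m) (fun k => (INR k + r) * f k).
Proof.
  intros [H1 H2]. split.
  - rewrite ddiff_leibniz, H1, H2 by lia. ring.
  - intros [|n] Hn; [lia|]. rewrite ddiff_leibniz, !H2 by lia. ring.
Qed.

Lemma ddiff_monic_poch (m j : nat) (x : R) (f : nat -> R) :
  ddiff_monic m f -> ddiff_monic (j + m) (fun k => poch (x + INR k) j * f k).
Proof.
  intros H. induction j as [|j IH].
  - apply (ddiff_monic_ext _ f); auto. intros. simpl. ring.
  - apply (ddiff_monic_linear _ (x + INR j)) in IH.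
    eapply ddiff_monic_ext; [|exact IH]. intros k. simpl. ring.
Qed.

(** * Moments of linear forms and their value at 1 *)

Lemma mu_moment_plus (a b c d : R) (f g : R -> R) (k : nat) (u v : R) :
  mu_moment a b c d f k u -> mu_moment a b c d g k v ->
  mu_moment a b c d (fun x => f x + g x) k (u + v).
Proof.
  unfold mu_moment. intros H1 H2.
  apply (improper_ext unit_interval _ _ exhausts_unit) with (2 := is_RInt_gen_plus _ _ _ _ H1 H2).
  intros x _. unfold plus; simpl. ring.
Qed.

Lemma mu_moment_scal (a b c d : R) (f : R -> R) (k : nat) (r u : R) :
  mu_moment a b c d f k u -> mu_moment a b c d (fun x => r * f x) k (r * u).
Proof.
  unfold mu_moment. intros H.
  apply (improper_ext unit_interval _ _ exhausts_unit) with (2 := is_RInt_gen_scal _ r _ H).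
  intros x _. unfold scal; simpl. unfold mult; simpl. ring.
Qed.

Lemma mu_moment_pow (a b c d : R) (f : R -> R) (k m : nat) (u : R) :
  mu_moment a b c d f (k + m) u -> mu_moment a b c d (fun x => x ^ m * f x) k u.
Proof.
  unfold mu_moment. intros H.
  apply (improper_ext unit_interval _ _ exhausts_unit) with (2 := H).
  intros x _. rewrite pow_add. ring.
Qed.

Lemma mu_moment_ext (a b c d : R) (f g : R -> R) (k : nat) (u : R) :
  (forall x, f x = g x) -> mu_moment a b c d f k u -> mu_moment a b c d g k u.
Proof.
  unfold mu_moment. intros E H.
  apply (improper_ext unit_interval _ _ exhausts_unit) with (2 := H).
  intros x _. now rewrite E.
Qed.

Lemma mu_moment_polyev (a b c d : R) (w : R -> R) (M : nat -> R) :
  (forall k, mu_moment a b c d w k (M k)) -> forall (A : nat -> R) (m k : nat),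
  mu_moment a b c d (fun x => polyev A m x * w x) k (polyev (fun i => A i * M (k + i)%nat) m 1).
Proof.
  intros H A m k. induction m as [|m IH].
  - assert (H0 := mu_moment_scal _ _ _ _ _ _ 0 _ (H k)). rewrite Rmult_0_l in H0. exact H0.
  - cbn [polyev]. rewrite pow1, Rmult_1_r.
    eapply mu_moment_ext;
      [|exact (mu_moment_plus _ _ _ _ _ _ _ _ _ IH
          (mu_moment_scal _ _ _ _ _ _ (A m) _ (mu_moment_pow _ _ _ _ _ _ m _ (H (k + m)%nat))))].
    intros x. simpl. ring.
Qed.

Lemma mu_moment_unique (a b c d : R) (f : R -> R) (k : nat) (u v : R) :
  mu_moment a b c d f k u -> mu_moment a b c d f k v -> u = v.
Proof. apply (improper_unique unit_interval _ _ exhausts_unit). Qed.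

Lemma mu_moment_pole (a b c d : R) (f : R -> R) (k : nat) (v : R) :
  nonpos_int c \/ nonpos_int d -> mu_moment a b c d f k v -> v = 0.
Proof.
  intros Hp H.
  assert (E : mu_const a b c d = 0).
  { unfold mu_const, Rdiv. destruct Hp as [Hp|Hp]; rewrite (Gamma_pole _ Hp); ring. }
  assert (H0 := mu_moment_scal _ _ _ _ _ _ 0 _ H). unfold mu_moment in *. rewrite E in *.
  rewrite <- (Rmult_0_l v). apply (improper_unique unit_interval _ _ exhausts_unit _ _ _ H).
  apply (improper_ext unit_interval _ _ exhausts_unit) with (2 := H0). intros; ring.
Qed.

(** This is where evaluation at 1 appears: every monomial contributes the same [s], so only the sum
    of the coefficients remains. *)
Lemma ddiff_polyev (n m : nat) (g : nat -> R) (A : nat -> R) (M : nat -> R) (s : R) :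
  (forall i, (i < m)%nat -> ddiff n (fun k => g k * M (k + i)%nat) = s) ->
  ddiff n (fun k => g k * polyev (fun i => A i * M (k + i)%nat) m 1) = polyev A m 1 * s.
Proof.
  intros H. induction m as [|m IH].
  - simpl. rewrite (ddiff_ext _ _ (fun k => 0 * g k)) by (intros; ring).
    rewrite ddiff_scal. ring.
  - cbn [polyev]. rewrite pow1.
    rewrite (ddiff_ext n _ (fun k => g k * polyev (fun i => A i * M (k + i)%nat) m 1
                                     + A m * (g k * M (k + m)%nat))) by (intros; ring).
    rewrite ddiff_plus, IH, ddiff_scal, H by (auto with arith). ring.
Qed.

(* [ddiff n (fun k => kernel_coeff a b c d U V k * x ^ k)] is the polynomial [P] of the header. *)
Definition kernel_coeff (a b c d : R) (U V k : nat) : R :=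
  poch c (k + U) * poch d (k + V) / (poch a k * poch b k).

(** The bounds on [nA1] and [nA2] ensure that the subtractions U - i, V - i and U - (i + 1) are
    never truncated for the indices in use. *)
Lemma qform_at1_eq (a b c d : R) (U V n : nat) (A1 A2 : nat -> R) :
  0 < a -> 0 < b -> 0 < delta a b c d ->
  n = (U + V)%nat -> (nA1 n <= U + 1)%nat -> (nA1 n <= V + 1)%nat ->
  (nA2 n <= U)%nat -> (nA2 n <= V + 1)%nat ->
  typeI a b c d n A1 A2 ->
  qform_at1 a b c d n A1 A2 = / INR (fact n) * kernel_coeff a b c d U V n.
Proof.
  intros Ha Hb Hdelta En HU1 HV1 HU2 HV2 [Horth Hnorm].
  destruct (classic (nonpos_int c \/ nonpos_int d)) as [Hp|Hp].
  (* All moments vanish at a pole, so the normalisation would read 1 = 0. *)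
  { apply (mu_moment_pole _ _ _ _ _ _ _ Hp) in Hnorm. lra. }
  assert (Hc : ~ nonpos_int c) by tauto. assert (Hd : ~ nonpos_int d) by tauto. clear Hp.
  set (M1 := fun k => poch a k * poch b k / (poch c k * poch d k)).
  set (M2 := fun k => poch a k * poch b k / (poch c k * poch d k) * (c / b) * ((b + INR k) / (c + INR k))).
  set (g := kernel_coeff a b c d U V).
  set (J := fun k => polyev (fun i => A1 i * M1 (k + i)%nat) (nA1 n) 1
                     + polyev (fun i => A2 i * M2 (k + i)%nat) (nA2 n) 1).
  assert (HJ : forall k, mu_moment a b c d (qform a b c d n A1 A2) k (J k)).
  { intros k. apply (mu_moment_plus a b c d (fun x => polyev A1 (nA1 n) x * w1 a b c d x)
      (fun x => polyev A2 (nA2 n) x * w2 a b c d x)); apply mu_moment_polyev.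
    - intros. now apply w1_moment.
    - intros. now apply w2_moment. }
  assert (HJ0 : forall k, (k < n)%nat -> J k = 0)
    by (intros k Hk; exact (mu_moment_unique _ _ _ _ _ _ _ _ (HJ k) (Horth k Hk))).
  assert (HJn : J n = 1) by exact (mu_moment_unique _ _ _ _ _ _ _ _ (HJ n) Hnorm).
  assert (Hk0 : forall k, c + INR k <> 0) by (intros k E; apply Hc; exists k; lra).
  assert (Hpoch : forall x k i m, (i <= m)%nat ->
     poch x (k + m) = poch x (k + i) * poch (x + INR i + INR k) (m - i)).
  { intros x k i m Him. replace (k + m)%nat with (k + i + (m - i))%nat by lia.
    rewrite poch_add, plus_INR. f_equal. f_equal. ring. }
  assert (D1 : forall i, (i < nA1 n)%nat -> ddiff n (fun k => g k * M1 (k + i)%nat) = 1).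
  { intros i Hi.
    (* What survives cancellation is (a+k)_i (b+k)_i (c+i+k)_(U-i) (d+i+k)_(V-i), monic of degree n
       in [k]. *)
    assert (Hm := ddiff_monic_poch _ i a _ (ddiff_monic_poch _ i b _
      (ddiff_monic_poch _ (U - i) (c + INR i) _ (ddiff_monic_poch _ (V - i) (d + INR i) _ ddiff_monic_1)))).
    replace (i + (i + (U - i + (V - i + 0))))%nat with n in Hm by lia.
    rewrite <- (proj1 Hm). apply ddiff_ext. intros k _. unfold g, kernel_coeff, M1.
    rewrite (Hpoch c k i U), (Hpoch d k i V) by lia.
    rewrite (poch_add a), (poch_add b).
    assert (Pa := poch_pos a k Ha). assert (Pb := poch_pos b k Hb).
    assert (Pc := poch_neq_0 c (k + i) Hc). assert (Pd := poch_neq_0 d (k + i) Hd).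
    field. repeat split; auto; lra. }
  assert (D2 : forall i, (i < nA2 n)%nat -> ddiff n (fun k => g k * M2 (k + i)%nat) = c / b).
  { intros i Hi.
    (* The factor (b+k+i)/(c+k+i) lengthens the symbol in [b] and shortens the one in [c], leaving
       the degree equal to n; c/b stays in front and matches [w2] at 1. *)
    assert (Hm := ddiff_monic_poch _ i a _ (ddiff_monic_poch _ (S i) b _
      (ddiff_monic_poch _ (U - S i) (c + INR (S i)) _ (ddiff_monic_poch _ (V - i) (d + INR i) _ ddiff_monic_1)))).
    replace (i + (S i + (U - S i + (V - i + 0))))%nat with n in Hm by lia.
    rewrite <- (Rmult_1_r (c / b)), <- (proj1 Hm), <- ddiff_scal.
    apply ddiff_ext. intros k _. unfold g, kernel_coeff, M2.
    rewrite (Hpoch c k (S i) U), (Hpoch d k i V) by lia.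
    rewrite (poch_add a), (poch_add b), Nat.add_succ_r. cbn [poch]. rewrite plus_INR.
    assert (Pa := poch_pos a k Ha). assert (Pb := poch_pos b k Hb).
    assert (Pc := poch_neq_0 c (k + i) Hc). assert (Pd := poch_neq_0 d (k + i) Hd).
    assert (Pk := Hk0 (k + i)%nat). rewrite plus_INR in Pk.
    field. repeat split; auto; lra. }
  (* One divided difference evaluated twice: by linearity in [A1] and [A2], and by orthogonality,
     which leaves only the node n. *)
  transitivity (ddiff n (fun k => g k * J k)).
  - rewrite (ddiff_ext n _ (fun k => g k * polyev (fun i => A1 i * M1 (k + i)%nat) (nA1 n) 1
      + g k * polyev (fun i => A2 i * M2 (k + i)%nat) (nA2 n) 1)) by (intros; unfold J; ring).
    rewrite ddiff_plus, (ddiff_polyev _ _ g A1 M1 1 D1), (ddiff_polyev _ _ g A2 M2 (c / b) D2).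
    reflexivity.
  - rewrite ddiff_top by (intros k Hk; rewrite HJ0 by auto; ring).
    rewrite HJn. unfold Rdiv. fold g. ring.
Qed.

Theorem theorem7 (a b c d : R)
  (Ha : 0 < a) (Hb : 0 < b) (Hdelta : 0 < delta a b c d)
  (H1 : ~ nonpos_int (d - a)) (H2 : ~ nonpos_int (d - b))
  (H3 : ~ nonpos_int (c + 1 - a)) (H4 : ~ nonpos_int (c - b))
  (n : nat) :
  (forall A1 A2 : nat -> R, typeI a b c d (2 * n) A1 A2 ->
     qform_at1 a b c d (2 * n) A1 A2 =
       / INR (fact (2 * n)) *
       (poch c (3 * n) * poch d (3 * n) / (poch a (2 * n) * poch b (2 * n)))) /\
  (forall A1 A2 : nat -> R, typeI a b c d (2 * n + 1) A1 A2 ->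
     qform_at1 a b c d (2 * n + 1) A1 A2 =
       / INR (fact (2 * n + 1)) *
       (poch c (3 * n + 2) * poch d (3 * n + 1) / (poch a (2 * n + 1) * poch b (2 * n + 1)))).
Proof.
  assert (E1 : nA1 (2 * n) = (n + 1)%nat) by (unfold nA1; f_equal; symmetry; apply (Nat.div_unique _ _ _ 0); lia).
  assert (E2 : nA2 (2 * n) = n) by (unfold nA2; symmetry; apply (Nat.div_unique _ _ _ 1); lia).
  assert (E3 : nA1 (2 * n + 1) = (n + 1)%nat) by (unfold nA1; f_equal; symmetry; apply (Nat.div_unique _ _ _ 1); lia).
  assert (E4 : nA2 (2 * n + 1) = (n + 1)%nat) by (unfold nA2; symmetry; apply (Nat.div_unique _ _ _ 0); lia).
  split; intros A1 A2 H.
  - rewrite (qform_at1_eq a b c d n n) by (auto; lia). unfold kernel_coeff.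
    now replace (2 * n + n)%nat with (3 * n)%nat by lia.
  (* Here [A2] has n + 1 coefficients, which forces U >= n + 1, while [A1] forces V >= n; as U + V =
     2n + 1, the split is determined. *)
  - rewrite (qform_at1_eq a b c d (n + 1) n) by (auto; lia). unfold kernel_coeff.
    replace (2 * n + 1 + (n + 1))%nat with (3 * n + 2)%nat by lia.
    now replace (2 * n + 1 + n)%nat with (3 * n + 1)%nat by lia.
Qed.
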